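(* For $i\in\{1,2\}$ let $(\tau_1(i),\tau_2(i))$ be $\operatorname{CDPH}(\bm{\alpha}(i),\bm{P}(i),\bm{U}(i),\bm{Q}_1(i),\bm{Q}_2(i))$ distributed with state sets $\mathcal{E}(i)$, $\mathcal{S}(i)$, and suppose $(\tau_1(1),\tau_2(1))$ and $(\tau_1(2),\tau_2(2))$ are independent. Let $(\tau_{1,\mathrm{sum}},\tau_{2,\mathrm{sum}})=(\tau_1(1)+\tau_1(2),\tau_2(1)+\tau_2(2))$. Then $(\tau_{1,\mathrm{sum}},\tau_{2,\mathrm{sum}})$ follows a $\operatorname{CDPH}(\bm{\alpha}_{\mathrm{sum}},\bm{P}_{\mathrm{sum}},\bm{U}_{\mathrm{sum}},\bm{Q}_{1,\mathrm{sum}},\bm{Q}_{2,\mathrm{sum}})$ distribution, where $$\bm{\alpha}_{\mathrm{sum}}:=(\bm{\alpha}(1),\bm{0}),\qquad \bm{P}_{\mathrm{sum}}:=\begin{pmatrix}\bm{P}(1)&\bm{U}(1)\otimes\bm{\alpha}(2)\\ \bm{0}&\bm{I}\otimes\bm{P}(2)\end{pmatrix},\qquad \bm{U}_{\mathrm{sum}}:=\begin{pmatrix}\bm{0}&\bm{0}\\ \bm{I}\otimes\bm{U}(2)&\bm{0}\end{pmatrix},$$ $$\bm{Q}_{1,\mathrm{sum}}:=\begin{pmatrix}\bm{Q}_1(1)\otimes\bm{I}&\bm{q}_1(1)\otimes\bm{I}\\ \bm{0}&\bm{Q}_1(2)\end{pmatrix},\qquad \bm{Q}_{2,\mathrm{sum}}:=\begin{pmatrix}\bm{Q}_2(1)\otimes\bm{I}&\bm{q}_2(1)\otimes\bm{I}\\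 \bm{0}&\bm{Q}_2(2)\end{pmatrix},$$ with $\bm{q}_1(1)=\bm{1}-\bm{Q}_1(1)\bm{1}$ and $\bm{q}_2(1)=\bm{1}-\bm{Q}_2(1)\bm{1}$. The state space corresponding to $\bm{P}_{\mathrm{sum}}$ is $\mathcal{E}_{\mathrm{sum}}:=\mathcal{E}(1)\cup(\mathcal{S}(1)\times\mathcal{E}(2))$ and that corresponding to $\bm{Q}_{1,\mathrm{sum}}$ and $\bm{Q}_{2,\mathrm{sum}}$ is $(\mathcal{S}(1)\times\mathcal{S}(2))\cup\mathcal{S}(2)$.
   Context: CDPH. $\mathcal{E}$ and $\mathcal{S}$ are disjoint nonempty finite sets. $\bm{\alpha}$ is a probability row vector indexed by $\mathcal{E}$; $\bm{P}$ is a subprobability matrix (nonnegative entries, row sums at most $1$) on $\mathcal{E}$; $\bm{U}$ is a nonnegative $\mathcal{E}\times\mathcal{S}$ matrix such that each row of $(\bm{P}\ \bm{U})$ sums to one; $\bm{Q}_1,\bm{Q}_2$ are subprobability matrices on $\mathcal{S}$. All chains terminate almost surely (from every state), i.e. all eigenvalues of $\bm{P},\bm{Q}_1,\bm{Q}_2$ have modulus strictly less than $1$. $M_1$ is a terminating Markov chain (time $n=0,1,2,\dots$) on $\mathcal{E}\cup\mathcal{S}$ with initial vector $(\bm{\alpha},\bm{0})$ and subprobability transition matrix $\begin{pmatrix}\bm{P}&\bm{U}\\ \bm{0}&\bm{Q}_1\end{pmatrix}$ (the missing mass in a row is the probability of terminating at the next step). Let $\tau_{1,2}:=\inf\{n\ge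 1: M_1(n)\notin\mathcal{E}\}$. Set $M_2(n)=M_1(n)$ for $n\le\tau_{1,2}$; after time $\tau_{1,2}$, given the past up to $\tau_{1,2}$, $M_2$ evolves independently of $M_1$ as a terminating Markov chain in $\mathcal{S}$ with subprobability matrix $\bm{Q}_2$. For $k\in\{1,2\}$, $\tau_k:=\inf\{n\ge 1: M_k(n)\notin\mathcal{E}\cup\mathcal{S}\}$. The law of $(\tau_1,\tau_2)$ is called $\operatorname{CDPH}(\bm{\alpha},\bm{P},\bm{U},\bm{Q}_1,\bm{Q}_2)$. $\otimes$ is the Kronecker product, product sets are ordered lexicographically, $\bm{I}$ is an identity matrix and $\bm{1}$ a column vector of ones of appropriate dimension. *)

(* Defs.v *)
From HB Require Import structures.
From mathcomp Require Import all_boot all_order all_algebra.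
From mathcomp Require Import complex mxtens.
From mathcomp Require Import all_classical all_reals all_analysis.
From mathcomp Require Import measurable_realfun.

Set Implicit Arguments.
Unset Strict Implicit.
Unset Printing Implicit Defensive.

Import Order.TTheory GRing.Theory Num.Theory.
Import numFieldNormedType.Exports.
Local Open Scope classical_set_scope.
Local Open Scope ring_scope.

(* The finite sets E and S are enumerated as 'I_e and 'I_s, and their disjoint
   union as 'I_(e + s): E is the range of [lshift s], S the range of
   [rshift e]. A terminating chain on 'I_n takes values in [option 'I_n], where
   [None] means that the chain has terminated. *)

Definition subprobability_mx (R : realType) (n : nat) (Q : 'M[R]_n) : Prop :=
  (forall i j, 0 <= Q i j) /\ (forall i, \sum_j Q i j <= 1).

(* The eigenvalues are the complex ones. *)
Definition eigenvalues_lt1 (R : realType) (n : nat) (Q : 'M[R]_n) : Prop :=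
  forall z : R[i], eigenvalue (map_mx (real_complex R) Q) z -> `|z| < 1.

Record CDPH_parameters (R : realType) (e s : nat) (alpha : 'rV[R]_e)
    (P : 'M[R]_e) (U : 'M[R]_(e, s)) (Q1 Q2 : 'M[R]_s) : Prop := {
  CDPH_E_nonempty : (0 < e)%N;
  CDPH_S_nonempty : (0 < s)%N;
  CDPH_alpha_ge0 : forall i, 0 <= alpha 0 i;
  CDPH_alpha_sum : \sum_i alpha 0 i = 1;
  CDPH_P_subprobability : subprobability_mx P;
  CDPH_U_ge0 : forall i j, 0 <= U i j;
  CDPH_PU_sum : forall i, \sum_j row_mx P U i j = 1;
  CDPH_Q1_subprobability : subprobability_mx Q1;
  CDPH_Q2_subprobability : subprobability_mx Q2;
  CDPH_P_terminating : eigenvalues_lt1 P;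
  CDPH_Q1_terminating : eigenvalues_lt1 Q1;
  CDPH_Q2_terminating : eigenvalues_lt1 Q2
}.

Definition initial_prob (R : realType) (n : nat) (a : 'rV[R]_n)
    (x : option 'I_n) : R :=
  if x is Some i then a 0 i else 1 - \sum_i a 0 i.

Definition transition_prob (R : realType) (n : nat) (Q : 'M[R]_n)
    (x y : option 'I_n) : R :=
  match x, y with
  | Some i, Some j => Q i j
  | Some i, None => 1 - \sum_j Q i j
  | None, Some _ => 0
  | None, None => 1
  end.

Definition path_event (T X : Type) (M : nat -> T -> X) (x : nat -> X) (k : nat)
    : set T :=
  [set w | forall i, (i <= k)%N -> M i w = x i].

(* inf {n >= 1 : M n \notin A}, equal to +oo when M never leaves A. *)
Definition exit_time (R : realType) (T X : Type) (M : nat -> T -> X)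
    (A : set X) (w : T) : \bar R :=
  ereal_inf [set n%:R%:E | n in [set n : nat | (1 <= n)%N /\ ~ A (M n w)]].

Definition E_states (e s : nat) : set (option 'I_(e + s)) :=
  [set Some (lshift s i) | i in [set: 'I_e]].

Definition ES_states (e s : nat) : set (option 'I_(e + s)) :=
  [set Some i | i in [set: 'I_(e + s)]].

Definition tau12 (R : realType) (e s : nat) (T : Type)
    (M1 : nat -> T -> option 'I_(e + s)) : T -> \bar R :=
  exit_time R M1 (@E_states e s).

Definition tau (R : realType) (e s : nat) (T : Type)
    (M : nat -> T -> option 'I_(e + s)) : T -> \bar R :=
  exit_time R M (@ES_states e s).

(* The event that tau12 = t and that M1 follows x up to time t. These events
   are the atoms of the past of M1 up to the (finite) time tau12. *)
Definition past_event (R : realType) (e s : nat) (T : Type)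
    (M1 : nat -> T -> option 'I_(e + s)) (x : nat -> option 'I_(e + s))
    (t : nat) : set T :=
  [set w | tau12 R M1 w = t%:R%:E] `&` path_event M1 x t.

Definition shift_time (T X : Type) (t : nat) (M : nat -> T -> X) :
    nat -> T -> X :=
  fun n => M (t + n)%N.

(* Conditional probabilities given an event F are multiplied out by the
   probability of F, so that null events need no separate treatment. *)
Record CDPH_chains (R : realType) (e s : nat) (alpha : 'rV[R]_e)
    (P : 'M[R]_e) (U : 'M[R]_(e, s)) (Q1 Q2 : 'M[R]_s)
    (d : measure_display) (T : measurableType d) (Pr : probability T R)
    (M1 M2 : nat -> T -> option 'I_(e + s)) : Prop := {
  CDPH_M1_measurable : forall n x, measurable [set w | M1 n w = x];
  CDPH_M2_measurable : forall n x, measurable [set w | M2 n w = x];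
  CDPH_M1_initial : forall x,
    Pr [set w | M1 0%N w = x] = (initial_prob (row_mx alpha 0) x)%:E;
  CDPH_M1_markov : forall (x : nat -> option 'I_(e + s)) k,
    (Pr (path_event M1 x k.+1) =
     Pr (path_event M1 x k) *
       (transition_prob (block_mx P U 0 Q1) (x k) (x k.+1))%:E)%E;
  CDPH_M2_before : forall n w,
    (n%:R%:E <= tau12 R M1 w)%E -> M2 n w = M1 n w;
  (* Given the past up to tau12 = t, the sequence M2 t, M2 (t + 1), ... is a
     terminating Markov chain in S with matrix Q2. *)
  CDPH_M2_markov : forall (x : nat -> option 'I_(e + s)) t
      (y : nat -> option 'I_s) k,
    let F := past_event R M1 x t in
    let N2 := shift_time t M2 in
    let z := fun i => omap (@rshift e s) (y i) in
    (Pr (F `&` path_event N2 z k.+1) =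
     Pr (F `&` path_event N2 z k) *
       (transition_prob Q2 (y k) (y k.+1))%:E)%E;
  (* M1 and M2 after time tau12 = t are independent given the past. *)
  CDPH_M2_independent : forall (x : nat -> option 'I_(e + s)) t
      (y1 y2 : nat -> option 'I_(e + s)) k1 k2,
    let F := past_event R M1 x t in
    let A1 := path_event (shift_time t M1) y1 k1 in
    let A2 := path_event (shift_time t M2) y2 k2 in
    (Pr (F `&` A1 `&` A2) * Pr F = Pr (F `&` A1) * Pr (F `&` A2))%E
}.

(* The times are extended-real valued because an infimum over the empty set may
   occur, on an event of probability zero. *)
Definition CDPH (R : realType) (e s : nat) (alpha : 'rV[R]_e)
    (P : 'M[R]_e) (U : 'M[R]_(e, s)) (Q1 Q2 : 'M[R]_s)
    (mu : set (\bar R * \bar R) -> \bar R) : Prop :=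
  CDPH_parameters alpha P U Q1 Q2 /\
  exists (d : measure_display) (T : measurableType d) (Pr : probability T R)
    (M1 M2 : nat -> T -> option 'I_(e + s)),
    CDPH_chains alpha P U Q1 Q2 Pr M1 M2 /\
    forall A : set (\bar R * \bar R), measurable A ->
      mu A = pushforward Pr (fun w => (tau R M1 w, tau R M2 w)) A.

Definition independent_pairs (R : realType) (d : measure_display)
    (T : measurableType d) (Pr : probability T R)
    (X Y : T -> \bar R * \bar R) : Prop :=
  forall A B : set (\bar R * \bar R), measurable A -> measurable B ->
    (Pr ((X @^-1` A) `&` (Y @^-1` B)) = Pr (X @^-1` A) * Pr (Y @^-1` B))%E.

Definition exit_cV (R : realType) (n : nat) (Q : 'M[R]_n) : 'cV[R]_n :=
  const_mx 1 - Q *m const_mx 1.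

(* [A *t B] is the Kronecker product; [mxtens_index] orders product indices
   lexicographically. The casts remove a dimension factor 1. *)

Definition alpha_sum (R : realType) (e1 s1 e2 : nat) (alpha1 : 'rV[R]_e1) :
    'rV[R]_(e1 + s1 * e2) :=
  row_mx alpha1 0.

Definition P_sum (R : realType) (e1 s1 e2 : nat) (P1 : 'M[R]_e1)
    (U1 : 'M[R]_(e1, s1)) (alpha2 : 'rV[R]_e2) (P2 : 'M[R]_e2) :
    'M[R]_(e1 + s1 * e2) :=
  block_mx P1 (castmx (muln1 e1, erefl (s1 * e2)%N) (U1 *t alpha2))
           0  ((1%:M : 'M[R]_s1) *t P2).

Definition U_sum (R : realType) (e1 s1 e2 s2 : nat) (U2 : 'M[R]_(e2, s2)) :
    'M[R]_(e1 + s1 * e2, s1 * s2 + s2) :=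
  block_mx 0                           0
           ((1%:M : 'M[R]_s1) *t U2)   0.

Definition Q_sum (R : realType) (s1 s2 : nat) (Q1 : 'M[R]_s1)
    (Q2 : 'M[R]_s2) : 'M[R]_(s1 * s2 + s2) :=
  block_mx (Q1 *t (1%:M : 'M[R]_s2))
           (castmx (erefl (s1 * s2)%N, mul1n s2)
              (exit_cV Q1 *t (1%:M : 'M[R]_s2)))
           0 Q2.

(* Main.v *)
Require Import Defs.
From HB Require Import structures.
From mathcomp Require Import all_boot all_order all_algebra.
From mathcomp Require Import complex mxtens.
From mathcomp Require Import all_classical all_reals all_analysis.
From mathcomp Require Import measurable_realfun.
From mathcomp Require Import ring zify.

Set Implicit Arguments.
Unset Strict Implicit.
Unset Printing Implicit Defensive.

Import Order.TTheory GRing.Theory Num.Theory.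
Import numFieldNormedType.Exports.
Local Open Scope classical_set_scope.
Local Open Scope ring_scope.

(** The law of a CDPH pair depends on its parameters only, and it is explicit.
With [t + 1] the time at which the common part of the chains enters S, [k] the
entrance state, and [a + 1], [b + 1] the times that the two chains then still
need to terminate, the quadruple [(t, k, a, b)] has probability

  (alpha P^t U)_k (Q1^a q1)_k (Q2^b q2)_k,   q_i = 1 - Q_i 1,

and the pair of termination times is [(t + a + 2, t + b + 2)]. The expectation
of a function of the pair under this law is [cdph_mean]. The proof has three
ingredients.

- The law is determined ([chains_law]). Each way of filling in the states of a
quadruple is a finite history of the two chains. The event that the chains run
through it has a product probability by the Markov properties and the
conditional independence ([history_event_prob]), these events are disjoint, and
their probabilities add up to 1 because the chains terminate. Termination comes
from the eigenvalues: [Q^n 1] decreases to a vector fixed by [Q], which must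
vanish as 1 is not an eigenvalue ([survival_cvg0]).

- The law is attained ([CDPH_chains_exist]). Since almost every trajectory is
finite, a countable space of pairs of finite paths carries the two chains.

- The parameters of the sum produce the convolution ([cdph_mean_sum]). The
matrices of the sum are block triangular, and the powers of such a matrix on a
vector supported on the second block are convolutions of the powers of the
diagonal blocks ([power_apply_block_trig]); the Kronecker products make each
block act on its own coordinate. Hence the entrance time and each of the two
remaining times of the sum are convolutions, all three for the same pair
[(k, k')] of entrance states.

Independence of the two given pairs turns the law of their sum into the same
convolution ([independent_sum_law]), so the canonical chains with the
parameters of the sum have the law of the sum. *)

(** * Sums of nonnegative families *)

Section esums.
Local Open Scope ereal_scope.
Context {R : realType}.

Lemma esum_finType (I : finType) (a : I -> \bar R) : (forall i, 0 <= a i) ->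
  \esum_(i in [set: I]) a i = \sum_i a i.
Proof.
move=> a0; rewrite esum_fset//; last exact: finite_finset.
rewrite fsbig_finite//=; apply: perm_big.
apply: uniq_perm; [exact: finmap.fset_uniq|exact: index_enum_uniq|move=> i].
rewrite in_fset_set ?mem_index_enum; [exact: mem_set|exact: finite_finset].
Qed.

Lemma esumZl (T : choiceType) (A : set T) (a : T -> \bar R) (c : R) :
  (0 <= c)%R -> (forall i, 0 <= a i) ->
  \esum_(i in A) (c%:E * a i) = c%:E * \esum_(i in A) a i.
Proof.
move=> c0 a0; rewrite /esum -ereal_supZl//; last first.
  by apply/set0P; exists 0, set0; [exact: fsets_set0|rewrite fsbig_set0].
congr ereal_sup; rewrite [RHS]image_comp; apply: eq_imagel => X [finX _] /=.
by rewrite ge0_mule_fsumr.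
Qed.

Lemma esum_pair (S T : choiceType) (a : S -> T -> \bar R) :
  (forall i j, 0 <= a i j) ->
  \esum_(i in [set: S]) \esum_(j in [set: T]) a i j =
  \esum_(k in [set: S * T]) a k.1 k.2.
Proof.
by move=> a0; rewrite esum_esum//; congr esum; apply/seteqP; split => -[].
Qed.

Lemma exchange_esum (S T : choiceType) (a : S -> T -> \bar R) :
  (forall i j, 0 <= a i j) ->
  \esum_(i in [set: S]) \esum_(j in [set: T]) a i j =
  \esum_(j in [set: T]) \esum_(i in [set: S]) a i j.
Proof.
move=> a0; rewrite !esum_pair//.
rewrite (reindex_esum [set: T * S] _ (fun k => (k.2, k.1)))//.
split => //; first by move=> [? ?] [? ?] _ _ [-> ->].
by move=> [i j] _; exists (j, i).
Qed.

(** The left-hand side is the right-hand one grouped by [n = a + b + 1]. Here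
[a + 1], [b + 1] and [n + 1] stand for the durations of two consecutive phases
and for their total duration. *)
Lemma esum_convolution (F : nat -> nat -> R) (H : nat -> \bar R) :
  (forall a b, 0 <= F a b)%R -> (forall n, 0 <= H n) ->
  \esum_(n in [set: nat]) ((\sum_(a < n) F a (n.-1 - a)%N)%:E * H n) =
  \esum_(a in [set: nat]) \esum_(b in [set: nat]) ((F a b)%:E * H (a + b).+1).
Proof.
move=> F0 H0.
transitivity (\esum_(n in [set: nat]) \esum_(a in `I_n)
    ((F a (n.-1 - a)%N)%:E * H n)).
  apply: eq_esum => n _.
  rewrite -sumEFin ge0_sume_distrl; last by move=> i _; rewrite lee_fin.
  rewrite -(@esum_finType 'I_n (fun a => (F a (n.-1 - a)%N)%:E * H n)); last first.
    by move=> i; rewrite mule_ge0// lee_fin.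
  rewrite (reindex_esum [set: 'I_n] `I_n (@nat_of_ord n))//; split.
  - by move=> i _ /=.
  - by move=> i j _ _ /val_inj.
  - by move=> i /= lin; exists (Ordinal lin).
rewrite esum_esum; last by move=> i j _ _; rewrite mule_ge0// lee_fin.
rewrite esum_pair; last by move=> i j; rewrite mule_ge0// lee_fin.
rewrite (reindex_esum [set: nat * nat] _ (fun k => ((k.1 + k.2).+1, k.1))).
  by apply: eq_esum => -[a b] _ /=; rewrite addKn.
split.
- by move=> [a b] _ /=; split => //=; rewrite ltnS leq_addr.
- move=> [a b] [a' b'] _ _ /= [sumE aE]; rewrite aE in sumE *.
  by rewrite (addnI sumE).
- move=> [n a] /= [_]; case: n => //= n; rewrite ltnS => an.
  by exists (a, (n - a)%N) => //=; rewrite subnKC.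
Qed.

End esums.

(** * Weighted walks, matrix powers and termination *)

Section walks.
Context {R : realType} {n : nat}.
Implicit Types (Q : 'M[R]_n) (f : 'cV[R]_n).

(** The walk starts at [i], follows [p], and pays [f] at its last state. Taking
[f = exit_cV Q] the walk terminates there; taking [f] a column of [U] it enters
S there. *)
Fixpoint walk_weight Q f (i : 'I_n) (p : seq 'I_n) : R :=
  if p is j :: p' then Q i j * walk_weight Q f j p' else f i 0.

Lemma walk_weight_ge0 Q f i p : (forall j k, 0 <= Q j k) ->
  (forall j, 0 <= f j 0) -> 0 <= walk_weight Q f i p.
Proof.
by move=> Q0 f0; elim: p i => [|j p IH] i /=; rewrite ?mulr_ge0.
Qed.

(** [Q^k B], for rectangular [B] and in any dimension. *)
Definition power_apply m p (Q : 'M[R]_m) k (B : 'M[R]_(m, p)) : 'M[R]_(m, p) :=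
  iter k (mulmx Q) B.

Lemma power_apply_ge0 m p (Q : 'M[R]_m) k (B : 'M[R]_(m, p)) :
  (forall i j, 0 <= Q i j) -> (forall i j, 0 <= B i j) ->
  forall i j, 0 <= power_apply Q k B i j.
Proof.
move=> Q0 B0; elim: k => [|k IH] i j //=.
by rewrite mxE sumr_ge0// => l _; rewrite mulr_ge0.
Qed.

Lemma power_applyB m p (Q : 'M[R]_m) k (A B : 'M[R]_(m, p)) :
  power_apply Q k (A - B) = power_apply Q k A - power_apply Q k B.
Proof. by elim: k => //= k ->; rewrite mulmxBr. Qed.

Lemma power_applySr m p (Q : 'M[R]_m) k (B : 'M[R]_(m, p)) :
  power_apply Q k.+1 B = power_apply Q k (Q *m B).
Proof. by rewrite /power_apply iterSr. Qed.

Lemma power_apply_mul m p q (Q : 'M[R]_m) k (B : 'M[R]_(m, p))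
  (C : 'M[R]_(p, q)) : power_apply Q k (B *m C) = power_apply Q k B *m C.
Proof. by elim: k => //= k ->; rewrite mulmxA. Qed.

Section walk_sums.
Local Open Scope ereal_scope.

Lemma esum_walk_size Q f i k (c : \bar R) :
  (forall j k, 0 <= Q j k)%R -> (forall j, 0 <= f j 0)%R -> 0 <= c ->
  \esum_(p in [set p | size p = k]) ((walk_weight Q f i p)%:E * c) =
  (power_apply Q k f i 0)%:E * c.
Proof.
move=> Q0 f0; elim: k i c => [|k IH] i c c0.
  rewrite (_ : [set p | _] = [set [::]]); last first.
    by apply/seteqP; split=> [[]|_ ->].
  by rewrite esum_set1//= mule_ge0// lee_fin.
rewrite (reindex_esum ([set: 'I_n] `*` [set p | size p = k]) _
  (fun jp => jp.1 :: jp.2)); last first.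
  split.
  - by move=> [j p] [_ /= ->].
  - by move=> [j p] [j' p'] _ _ /= [-> ->].
  - by move=> [|j p] //= [pk]; exists (j, p).
transitivity (\esum_(j in [set: 'I_n]) \esum_(p in [set p | size p = k])
    ((walk_weight Q f j p)%:E * ((Q i j)%:E * c))).
  rewrite esum_esum; last first.
    move=> j p _ _; rewrite mule_ge0// ?lee_fin ?walk_weight_ge0//.
    by rewrite mule_ge0// lee_fin.
  apply: eq_esum => -[j p] _ /=; rewrite EFinM.
  by rewrite muleA (muleC (walk_weight Q f j p)%:E).
transitivity (\esum_(j in [set: 'I_n])
    ((power_apply Q k f j 0)%:E * ((Q i j)%:E * c))).
  by apply: eq_esum => j _; rewrite IH// mule_ge0// lee_fin.
have f0' (j : 'I_n) (l : 'I_1) : (0 <= f j l)%R by rewrite ord1.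
rewrite esum_finType; last first.
  move=> j; rewrite mule_ge0// ?lee_fin ?power_apply_ge0//.
  by rewrite mule_ge0// lee_fin.
rewrite /= mxE -sumEFin ge0_sume_distrl; last first.
  by move=> j _; rewrite lee_fin mulr_ge0 ?power_apply_ge0.
by apply: eq_bigr => j _; rewrite EFinM muleA (muleC (power_apply _ _ _ _ _)%:E).
Qed.

(** Prepending a state to a walk is one multiplication by [Q], so the walks of
length [k] have total weight [Q^k f]. *)
Lemma esum_walk Q f i (h : nat -> \bar R) :
  (forall j k, 0 <= Q j k)%R -> (forall j, 0 <= f j 0)%R ->
  (forall k, 0 <= h k) ->
  \esum_(p in [set: seq 'I_n]) ((walk_weight Q f i p)%:E * h (size p)) =
  \esum_(k in [set: nat]) ((power_apply Q k f i 0)%:E * h k).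
Proof.
move=> Q0 f0 h0.
rewrite (_ : [set: seq 'I_n] =
    \bigcup_(k in [set: nat]) [set p : seq 'I_n | size p = k]); last first.
  by apply/seteqP; split => // p _; exists (size p).
rewrite esum_bigcupT; first last.
- by move=> p; rewrite mule_ge0// lee_fin walk_weight_ge0.
- by apply/trivIsetP => k l _ _ /eqP kl; apply/seteqP; split => // p /= [-> /kl].
apply: eq_esum => k _; rewrite -esum_walk_size//.
by apply: eq_esum => p /= ->.
Qed.

End walk_sums.

End walks.

Section termination.
Context {R : realType} {n : nat}.
Implicit Types Q : 'M[R]_n.

Lemma exit_cVE Q i : exit_cV Q i 0 = 1 - \sum_j Q i j.
Proof.
by rewrite !mxE; congr (_ - _); apply: eq_bigr => j _; rewrite mxE mulr1.
Qed.

Lemma exit_cV_ge0 Q i : subprobability_mx Q -> 0 <= exit_cV Q i 0.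
Proof. by move=> [_ Q1]; rewrite exit_cVE subr_ge0. Qed.

(** Eigenvalues are defined by row vectors; a matrix and its transpose have the
same characteristic polynomial. *)
Lemma right_eigenvector_eigenvalue Q (z : R) (v : 'cV[R]_n) :
  Q *m v = z *: v -> v != 0 -> eigenvalue Q z.
Proof.
move=> Qv v0; rewrite eigenvalue_root_char.
suff : eigenvalue Q^T z.
  rewrite eigenvalue_root_char /char_poly.
  suff -> : char_poly_mx Q^T = (char_poly_mx Q)^T by rewrite det_tr.
  by rewrite /char_poly_mx linearB/= tr_scalar_mx map_trmx.
apply/eigenvalueP; exists v^T; first by rewrite -trmx_mul Qv linearZ.
by apply: contra v0 => /eqP /(congr1 trmx); rewrite trmxK trmx0 => ->.
Qed.

(** The probability that the chain started at [i] is alive after [k] steps. *)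
Definition survival Q k i : R := power_apply Q k (const_mx 1 : 'cV[R]_n) i 0.

(** The survival probabilities of a subprobability matrix decrease, and their
limit is a vector fixed by [Q]. If it were nonzero, 1 would be an eigenvalue. *)
Lemma survival_cvg0 Q i : subprobability_mx Q -> eigenvalues_lt1 Q ->
  survival Q k i @[k --> \oo] --> (0 : R).
Proof.
move=> [Q0 Q1] eigQ.
have surv0 k j : 0 <= survival Q k j by apply: power_apply_ge0 => // ? ?; rewrite mxE.
have survS k j : survival Q k.+1 j = \sum_l Q j l * survival Q k l.
  by rewrite /survival /= mxE.
have survN j : nonincreasing_seq (survival Q ^~ j).
  apply/nonincreasing_seqP => k; elim: k j => [|k IH] j.
    rewrite survS /survival /= mxE (le_trans _ (Q1 j))//.
    by apply: ler_sum => l _; rewrite mxE mulr1.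
  by rewrite survS [leRHS]survS; apply: ler_sum => l _; rewrite ler_wpM2l.
have cv j : cvg (survival Q k j @[k --> \oo]).
  apply: nonincreasing_is_cvgn; first exact: survN.
  by exists 0 => _ [k _ <-].
pose v := \col_j lim (survival Q k j @[k --> \oo]).
have Qv : Q *m v = 1 *: v.
  apply/matrixP => j l; rewrite ord1 scale1r !mxE.
  have lim1 : survival Q k.+1 j @[k --> \oo] -->
      \sum_l Q j l * lim (survival Q k l @[k --> \oo]).
    under eq_fun do rewrite survS.
    apply: cvg_big => [|m _]; first exact: add_continuous.
    apply: cvgM; [exact: cvg_cst|exact: cv].
  have lim2 : survival Q k.+1 j @[k --> \oo] --> lim (survival Q k j @[k --> \oo]).
    by have := cv j; rewrite -(cvg_shiftS (survival Q ^~ j)).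
  rewrite (cvg_unique _ lim2 lim1)//.
  by apply: eq_bigr => m _; rewrite mxE.
have [v0|v0] := eqVneq v 0; last first.
  have /(right_eigenvector_eigenvalue) := Qv => /(_ v0).
  rewrite -(eigenvalue_map (real_complex R)) => /eigQ.
  by rewrite rmorph1 normr1 ltxx.
have /matrixP/(_ i 0) := v0; rewrite !mxE => <-; exact: cv.
Qed.

(** Telescoping: the exit vector is [1 - Q 1]. *)
Lemma sum_exit_survival Q i k :
  \sum_(0 <= m < k) power_apply Q m (exit_cV Q) i 0 = 1 - survival Q k i.
Proof.
elim: k => [|k IH]; first by rewrite big_nil /survival /= mxE subrr.
rewrite big_nat_recr//= IH /survival /exit_cV power_applyB -power_applySr.
by rewrite [X in _ + X]mxE [X in _ + (_ + X)]mxE addrA subrK.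
Qed.

Lemma esum_exit Q i : subprobability_mx Q -> eigenvalues_lt1 Q ->
  (\esum_(k in [set: nat]) (power_apply Q k (exit_cV Q) i 0)%:E = 1)%E.
Proof.
move=> subQ eigQ; have q0 m : 0 <= power_apply Q m (exit_cV Q) i 0.
  apply: power_apply_ge0; first exact: subQ.1.
  by move=> j l; rewrite ord1 exit_cV_ge0.
rewrite -nneseries_esumT//.
apply/cvg_lim => //; under eq_fun do rewrite sumEFin sum_exit_survival.
apply/fine_cvgP; split; first exact: nearW.
rewrite -[X in _ --> X]subr0; apply: cvgB; first exact: cvg_cst.
exact: survival_cvg0.
Qed.

Lemma esum_exit_walk Q i : subprobability_mx Q -> eigenvalues_lt1 Q ->
  (\esum_(p in [set: seq 'I_n]) (walk_weight Q (exit_cV Q) i p)%:E = 1)%E.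
Proof.
move=> subQ eigQ; rewrite -(esum_exit i subQ eigQ).
have := @esum_walk R n Q (exit_cV Q) i (fun=> 1%E) subQ.1.
under eq_esum do rewrite mule1; move=> ->//; last first.
  by move=> j; exact: exit_cV_ge0.
by under eq_esum do rewrite mule1.
Qed.

End termination.

(** * Parameters of the sum *)

Section spectra.

Lemma sum_mxtens (V : nmodType) m n (F : 'I_(m * n) -> V) :
  \sum_k F k = \sum_i \sum_j F (mxtens_index (i, j)).
Proof.
rewrite pair_big (reindex (@mxtens_index m n))/=.
  by apply: eq_bigr => -[].
by exists (@mxtens_unindex m n) => k _; rewrite (mxtens_indexK, mxtens_unindexK).
Qed.

(** If the first part of a row eigenvector is nonzero, it is an eigenvector of
[A]; otherwise the second part is one of [D]. *)
Lemma eigenvalue_block_trig (F : fieldType) m n (A : 'M[F]_m)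
    (B : 'M[F]_(m, n)) (D : 'M[F]_n) (z : F) :
  eigenvalue (block_mx A B 0 D) z -> eigenvalue A z \/ eigenvalue D z.
Proof.
case/eigenvalueP => u; rewrite -[u]hsubmxK mul_row_block scale_row_mx.
set v := lsubmx u; set w := rsubmx u.
rewrite mulmx0 addr0 => /eq_row_mx[vA wD] uN0.
have [v0|vN0] := eqVneq v 0; last by left; apply/eigenvalueP; exists v.
right; apply/eigenvalueP; exists w; first by rewrite -wD v0 mul0mx add0r.
by apply: contraNneq uN0 => ->; rewrite v0 row_mx0.
Qed.

(** A row vector indexed by pairs is a family of slices, one for each second
coordinate, and [A *t 1] acts on each slice as [A]. *)
Lemma eigenvalue_tensmx1 (F : fieldType) m n (A : 'M[F]_m) (z : F) :
  eigenvalue (A *t (1%:M : 'M[F]_n)) z -> eigenvalue A z.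
Proof.
case/eigenvalueP => u uA uN0.
have [k uk] : exists k, u 0 k != 0 by apply/rV0Pn.
case: (mxtens_indexP k) uk => i j uij; apply/eigenvalueP.
exists (\row_i' u 0 (mxtens_index (i', j))); last first.
  by apply/rV0Pn; exists i; rewrite mxE.
apply/rowP => l; move/rowP/(_ (mxtens_index (l, j))): uA.
rewrite !mxE sum_mxtens => <-; apply: eq_bigr => i' _.
rewrite (bigD1 j)//= big1 ?addr0 => [|j' j'j]; rewrite tensmxE !mxE.
  by rewrite eqxx mulr1.
by rewrite (negbTE j'j) !mulr0.
Qed.

Lemma eigenvalue_tens1mx (F : fieldType) m n (A : 'M[F]_n) (z : F) :
  eigenvalue ((1%:M : 'M[F]_m) *t A) z -> eigenvalue A z.
Proof.
case/eigenvalueP => u uA uN0.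
have [k uk] : exists k, u 0 k != 0 by apply/rV0Pn.
case: (mxtens_indexP k) uk => i j uij; apply/eigenvalueP.
exists (\row_j' u 0 (mxtens_index (i, j'))); last first.
  by apply/rV0Pn; exists j; rewrite mxE.
apply/rowP => l; move/rowP/(_ (mxtens_index (i, l))): uA.
rewrite !mxE sum_mxtens => <-; rewrite [RHS](bigD1 i)//= [X in _ = _ + X]big1.
  by rewrite addr0; apply: eq_bigr => j' _; rewrite tensmxE !mxE eqxx mul1r.
move=> i' i'i; rewrite big1// => j' _.
by rewrite tensmxE !mxE (negbTE i'i) mul0r mulr0.
Qed.

Context {R : realType}.

Lemma eigenvalues_lt1_block_trig m n (A : 'M[R]_m) (B : 'M[R]_(m, n))
    (D : 'M[R]_n) : eigenvalues_lt1 A -> eigenvalues_lt1 D ->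
  eigenvalues_lt1 (block_mx A B 0 D).
Proof.
move=> ltA ltD z; rewrite map_block_mx map_mx0.
by case/eigenvalue_block_trig => [/ltA|/ltD].
Qed.

Lemma eigenvalues_lt1_tensmx1 m n (A : 'M[R]_m) : eigenvalues_lt1 A ->
  eigenvalues_lt1 (A *t (1%:M : 'M[R]_n)).
Proof.
by move=> ltA z; rewrite map_mxT map_mx1 => /eigenvalue_tensmx1/ltA.
Qed.

Lemma eigenvalues_lt1_tens1mx m n (A : 'M[R]_n) : eigenvalues_lt1 A ->
  eigenvalues_lt1 ((1%:M : 'M[R]_m) *t A).
Proof.
by move=> ltA z; rewrite map_mxT map_mx1 => /eigenvalue_tens1mx/ltA.
Qed.

End spectra.

Section stochasticity.
Context {R : realType}.

Lemma subprobability_block_trig m n (A : 'M[R]_m) (B : 'M[R]_(m, n))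
    (D : 'M[R]_n) : (forall i j, 0 <= A i j) -> (forall i j, 0 <= B i j) ->
  (forall i, \sum_j row_mx A B i j <= 1) -> subprobability_mx D ->
  subprobability_mx (block_mx A B 0 D).
Proof.
move=> A0 B0 AB1 [D0 D1]; split=> i.
  move=> j; case: (split_ordP i) => i' ->; case: (split_ordP j) => j' ->.
  - by rewrite block_mxEul.
  - by rewrite block_mxEur.
  - by rewrite block_mxEdl mxE.
  - by rewrite block_mxEdr.
case: (split_ordP i) => i' ->.
  rewrite (le_trans _ (AB1 i'))//; apply: ler_sum => j _.
  by rewrite /block_mx col_mxEu.
rewrite big_split_ord/= big1 ?add0r; last first.
  by move=> j _; rewrite block_mxEdl mxE.
by rewrite (le_trans _ (D1 i'))//; apply: ler_sum => j _; rewrite block_mxEdr.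
Qed.

Lemma subprobability_tensmx1 m n (A : 'M[R]_m) : subprobability_mx A ->
  subprobability_mx (A *t (1%:M : 'M[R]_n)).
Proof.
move=> [A0 A1]; split=> k.
  by move=> l; rewrite !mxE mulr_ge0 ?ler0n.
case: (mxtens_indexP k) => i j; rewrite sum_mxtens (le_trans _ (A1 i))//.
apply: ler_sum => i' _; rewrite (bigD1 j)//= big1 ?addr0 => [|j' j'j].
  by rewrite tensmxE !mxE eqxx mulr1.
by rewrite tensmxE !mxE eq_sym (negbTE j'j) mulr0.
Qed.

Lemma sum_tens1mx m n p (A : 'M[R]_(n, p)) i j :
  \sum_k ((1%:M : 'M[R]_m) *t A) (mxtens_index (i, j)) k = \sum_l A j l.
Proof.
rewrite sum_mxtens (bigD1 i)//= [X in _ + X]big1 ?addr0.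
  by apply: eq_bigr => l _; rewrite tensmxE !mxE eqxx mul1r.
move=> i' i'i; rewrite big1// => l _.
by rewrite tensmxE !mxE eq_sym (negbTE i'i) mul0r.
Qed.

Lemma subprobability_tens1mx m n (A : 'M[R]_n) : subprobability_mx A ->
  subprobability_mx ((1%:M : 'M[R]_m) *t A).
Proof.
move=> [A0 A1]; split=> k.
  by move=> l; rewrite !mxE mulr_ge0 ?ler0n.
by case: (mxtens_indexP k) => i j; rewrite sum_tens1mx.
Qed.

(** The casts drop a factor 1 from a dimension and leave the entries alone. *)
Lemma castmx_tens_colE m n p (q : 'cV[R]_m) (A : 'M[R]_(n, p)) i j k :
  castmx (erefl (m * n)%N, mul1n p) (q *t A) (mxtens_index (i, j)) k =
  q i 0 * A j k.
Proof.
rewrite castmxE cast_ord_id -[RHS](tensmxE q A); congr (_ _ _).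
by apply: val_inj; rewrite /= mul0n.
Qed.

Lemma castmx_tens_rowE m n p (A : 'M[R]_(m, n)) (a : 'rV[R]_p) i j k :
  castmx (muln1 m, erefl (n * p)%N) (A *t a) i (mxtens_index (j, k)) =
  A i j * a 0 k.
Proof.
rewrite castmxE cast_ord_id -[RHS](tensmxE A a); congr (_ _ _).
by apply: val_inj; rewrite /= muln1 addn0.
Qed.

(** The mass that [Q1] loses at [i] is [exit_cV Q1 i], which the upper right
block hands over to the second chain. *)
Lemma sum_Q_sum_up s1 s2 (Q1 : 'M[R]_s1) (k : 'I_(s1 * s2)) :
  \sum_j row_mx (Q1 *t (1%:M : 'M[R]_s2))
    (castmx (erefl (s1 * s2)%N, mul1n s2)
       (exit_cV Q1 *t (1%:M : 'M[R]_s2))) k j = 1.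
Proof.
case: (mxtens_indexP k) => i l; rewrite big_split_ord/=.
under eq_bigr do rewrite row_mxEl.
under [X in _ + X]eq_bigr do rewrite row_mxEr castmx_tens_colE [X in _ * X]mxE.
rewrite -mulr_sumr [X in _ * X](bigD1 l)//= eqxx [X in _ * (_ + X)]big1.
  2: by move=> j jl; rewrite eq_sym (negbTE jl).
rewrite addr0 mulr1 exit_cVE sum_mxtens addrC -[RHS](subrK (\sum_j Q1 i j)).
congr (_ + _); apply: eq_bigr => i' _.
rewrite (bigD1 l)//= big1 ?addr0 => [|j j'j].
  by rewrite tensmxE !mxE eqxx mulr1.
by rewrite tensmxE !mxE eq_sym (negbTE j'j) mulr0.
Qed.

Lemma subprobability_Q_sum s1 s2 (Q1 : 'M[R]_s1) (Q2 : 'M[R]_s2) :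
  subprobability_mx Q1 -> subprobability_mx Q2 ->
  subprobability_mx (Q_sum Q1 Q2).
Proof.
move=> sQ1 sQ2; apply: subprobability_block_trig; last exact: sQ2.
- exact: (@subprobability_tensmx1 _ s2 _ sQ1).1.
- move=> k j; case: (mxtens_indexP k) => i l.
  by rewrite castmx_tens_colE [X in _ * X]mxE mulr_ge0 ?exit_cV_ge0 ?ler0n.
by move=> k; rewrite sum_Q_sum_up.
Qed.

Lemma eigenvalues_lt1_Q_sum s1 s2 (Q1 : 'M[R]_s1) (Q2 : 'M[R]_s2) :
  eigenvalues_lt1 Q1 -> eigenvalues_lt1 Q2 -> eigenvalues_lt1 (Q_sum Q1 Q2).
Proof.
by move=> ? ?; apply: eigenvalues_lt1_block_trig => //; exact: eigenvalues_lt1_tensmx1.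
Qed.

Lemma CDPH_parameters_sum e1 s1 e2 s2
    (alpha_1 : 'rV[R]_e1) (P_1 : 'M[R]_e1) (U_1 : 'M[R]_(e1, s1))
    (Q1_1 Q2_1 : 'M[R]_s1)
    (alpha_2 : 'rV[R]_e2) (P_2 : 'M[R]_e2) (U_2 : 'M[R]_(e2, s2))
    (Q1_2 Q2_2 : 'M[R]_s2) :
  CDPH_parameters alpha_1 P_1 U_1 Q1_1 Q2_1 ->
  CDPH_parameters alpha_2 P_2 U_2 Q1_2 Q2_2 ->
  CDPH_parameters (alpha_sum s1 e2 alpha_1) (P_sum P_1 U_1 alpha_2 P_2)
    (U_sum e1 s1 U_2) (Q_sum Q1_1 Q1_2) (Q_sum Q2_1 Q2_2).
Proof.
move=> [e10 s10 a10 a1s [P10 P11] U10 PU1 Q11 Q21 tP1 tQ11 tQ21].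
move=> [e20 s20 a20 a2s [P20 P21] U20 PU2 Q12 Q22 tP2 tQ12 tQ22].
have UA0 i j : 0 <= castmx (muln1 e1, erefl (s1 * e2)%N) (U_1 *t alpha_2) i j.
  by case: (mxtens_indexP j) => k l; rewrite castmx_tens_rowE mulr_ge0.
have UA i : \sum_j castmx (muln1 e1, erefl (s1 * e2)%N) (U_1 *t alpha_2) i j =
    \sum_j U_1 i j.
  rewrite sum_mxtens; apply: eq_bigr => j _.
  by under eq_bigr do rewrite castmx_tens_rowE; rewrite -mulr_sumr a2s mulr1.
have PUA i : \sum_j row_mx P_1 (castmx (muln1 e1, erefl (s1 * e2)%N)
    (U_1 *t alpha_2)) i j = 1.
  rewrite -(PU1 i) !big_split_ord/=.
  under eq_bigr do rewrite row_mxEl.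
  under [X in _ + X]eq_bigr do rewrite row_mxEr.
  rewrite UA; congr (_ + _); apply: eq_bigr => j _.
    by rewrite row_mxEl.
  by rewrite row_mxEr.
have subP : subprobability_mx (P_sum P_1 U_1 alpha_2 P_2).
  apply: subprobability_block_trig => //; first by move=> i; rewrite PUA.
  exact: subprobability_tens1mx.
split => //.
- by rewrite addn_gt0 e10.
- by rewrite addn_gt0 s20 orbT.
- move=> i; case: (split_ordP i) => j ->; first by rewrite row_mxEl.
  by rewrite row_mxEr mxE.
- rewrite big_split_ord/= -[RHS]a1s -[RHS]addr0; congr (_ + _).
    by apply: eq_bigr => i _; rewrite row_mxEl.
  by rewrite big1// => i _; rewrite row_mxEr mxE.
- move=> i j; case: (split_ordP i) => i' ->; case: (split_ordP j) => j' ->.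
  + by rewrite block_mxEul mxE.
  + by rewrite block_mxEur mxE.
  + by rewrite block_mxEdl !mxE mulr_ge0 ?ler0n.
  + by rewrite block_mxEdr mxE.
- move=> i; rewrite big_split_ord/=.
  under eq_bigr do rewrite row_mxEl.
  under [X in _ + X]eq_bigr do rewrite row_mxEr.
  rewrite /U_sum; case: (split_ordP i) => i' ->.
    rewrite [X in _ + X]big1 ?addr0; last first.
      by move=> j _; rewrite /block_mx col_mxEu row_mx0 mxE.
    rewrite -[RHS](PUA i'); apply: eq_bigr => j _.
    by rewrite /P_sum /block_mx col_mxEu.
  case: (mxtens_indexP i') => j k; rewrite !big_split_ord/=.
  rewrite big1 ?add0r; last by move=> l _; rewrite block_mxEdl mxE.
  under eq_bigr do rewrite block_mxEdr.
  under [X in _ + (X + _)]eq_bigr do rewrite block_mxEdl.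
  rewrite [X in _ + (_ + X)]big1 ?addr0; last first.
    by move=> l _; rewrite block_mxEdr mxE.
  rewrite !sum_tens1mx -[RHS](PU2 k) big_split_ord/=.
  by congr (_ + _); apply: eq_bigr => l _; rewrite ?row_mxEl ?row_mxEr.
- exact: subprobability_Q_sum.
- exact: subprobability_Q_sum.
- by apply: eigenvalues_lt1_block_trig => //; exact: eigenvalues_lt1_tens1mx.
- exact: eigenvalues_lt1_Q_sum.
- exact: eigenvalues_lt1_Q_sum.
Qed.

End stochasticity.

(** * Distribution of the finite paths of a terminating chain *)

Section path_prob.
Context {R : realType} {n : nat}.
Local Open Scope ereal_scope.
Variable Q : 'M[R]_n.
Hypotheses (subQ : subprobability_mx Q) (eigQ : eigenvalues_lt1 Q).
Implicit Types (a : option 'I_n -> R) (x : nat -> option 'I_n).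

(** [p] lists the states before termination, the first of them drawn from [a],
and [None] stands for a chain that is terminated from the start. *)
Definition path_prob a (p : seq 'I_n) : R :=
  if p is j :: p' then (a (Some j) * walk_weight Q (exit_cV Q) j p')%R
  else a None.

Definition is_pmf a :=
  (forall o, 0 <= a o)%R /\ (a None + \sum_j a (Some j) = 1)%R.

Lemma transition_pmf o : is_pmf (transition_prob Q o).
Proof.
split=> [p|]; last first.
  by case: o => [i|] /=; rewrite ?subrK// big1 ?addr0.
by case: o p => [i|] [j|] //=; [exact: subQ.1|rewrite subr_ge0; exact: subQ.2].
Qed.

Lemma walk_exit_ge0 j p : (0 <= walk_weight Q (exit_cV Q) j p)%R.
Proof.
by apply: walk_weight_ge0; [exact: subQ.1|move=> i; exact: exit_cV_ge0].
Qed.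

Lemma path_prob_ge0 a p : is_pmf a -> (0 <= path_prob a p)%R.
Proof. by case=> a0 _; case: p => //= j p; rewrite mulr_ge0// walk_exit_ge0. Qed.

Lemma path_prob_transition_some j p :
  path_prob (transition_prob Q (Some j)) p = walk_weight Q (exit_cV Q) j p.
Proof. by case: p => //=; rewrite exit_cVE. Qed.

Lemma path_prob_transition_none p :
  path_prob (transition_prob Q None) p = (p == [::])%:R%R.
Proof. by case: p => //= j p; rewrite mul0r. Qed.

Definition cylinder x k : set (seq 'I_n) :=
  [set p | forall i, (i <= k)%N -> onth p i = x i].

Definition cylinder_prob a x k : \bar R :=
  \esum_(p in cylinder x k) (path_prob a p)%:E.

Lemma esum_path_prob a : is_pmf a ->
  \esum_(p in [set: seq 'I_n]) (path_prob a p)%:E = 1.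
Proof.
move=> da; have [a0 a1] := da.
have pp0 p : 0 <= (path_prob a p)%:E by rewrite lee_fin path_prob_ge0.
rewrite (esumID [set [::]])// !setTI esum_set1//=.
rewrite (_ : ~` [set [::]] = (fun jp => jp.1 :: jp.2) @` [set: 'I_n * seq 'I_n]).
  rewrite esum_image; last by move=> [j p] [j' p'] _ _ /= [-> ->].
  rewrite -(@esum_pair _ _ _ (fun j p => (path_prob a (j :: p))%:E))//=.
  transitivity ((a None)%:E + \esum_(j in [set: 'I_n]) (a (Some j))%:E).
    congr (_ + _); apply: eq_esum => j _.
    under eq_esum do rewrite EFinM.
    rewrite esumZl//; last by move=> p; rewrite lee_fin walk_exit_ge0.
    by rewrite esum_exit_walk// mule1.
  rewrite esum_finType; last by move=> j; rewrite lee_fin.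
  by rewrite sumEFin -EFinD a1.
  by move=> j p; exact: (pp0 (j :: p)).
2: exact: pp0 [::].
apply/seteqP; split => [[|j p] //= _|_ [[j p] _ <-]//].
by exists (j, p).
Qed.

Lemma esum_singleton (T : choiceType) (A : set T) (t : T) (g : T -> \bar R) :
  0 <= g t -> (forall i, i <> t -> g i = 0) ->
  \esum_(i in A) g i = if t \in A then g t else 0.
Proof.
move=> g0 gt; have [tA|tA] := boolP (t \in A); last first.
  rewrite esum1// => i Ai; apply: gt => it; move/negP: tA; apply.
  by rewrite -it inE.
rewrite (esumID [set t]); last first.
  by move=> i _; have [->//|/eqP/gt->] := eqVneq i t.
rewrite (_ : A `&` [set t] = [set t]); last first.
  by apply/seteqP; split => [i []//|i ->]; split => //; rewrite inE in tA.
by rewrite esum_set1// esum1 ?adde0// => i [_ /gt].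
Qed.

(** First-step analysis. When [x 0] is [None] both sides only see the empty
path, which stays terminated. *)
Lemma cylinder_cons a x (A : set (seq 'I_n)) : is_pmf a ->
  \esum_(p in [set p | onth p 0 = x 0%N /\ A (behead p)]) (path_prob a p)%:E =
  (a (x 0%N))%:E *
    \esum_(p in A) (path_prob (transition_prob Q (x 0%N)) p)%:E.
Proof.
move=> da; case: (x 0%N) => [j|].
  rewrite (_ : [set p | _] = (cons j) @` A); last first.
    apply/seteqP; split => [[|i p] /= []// [->] Ap|_ [p Ap <-]//].
    by exists p.
  rewrite esum_image; last by move=> p p' _ _ [].
  under [in RHS]eq_esum do rewrite path_prob_transition_some.
  rewrite /= -esumZl ?da.1//.
  by move=> p; rewrite lee_fin walk_exit_ge0.
under [in RHS]eq_esum do rewrite path_prob_transition_none.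
rewrite (@esum_singleton _ A [::])/= ?lee01//; last by move=> p /eqP/negbTE ->.
rewrite (_ : [set p | _] = [set [::]] `&` A); last first.
  by apply/seteqP; split => [[|i p] []|[|i p] []].
rewrite esum_mkcondr esum_set1/=; last by case: ifP => // _; rewrite lee_fin da.1.
by case: ifP => _; rewrite ?mule1 ?mule0.
Qed.

Lemma cylinder_prob0 a x : is_pmf a -> cylinder_prob a x 0 = (a (x 0%N))%:E.
Proof.
move=> da; rewrite /cylinder_prob.
rewrite (_ : cylinder x 0 = [set p | onth p 0 = x 0%N /\ setT (behead p)]).
  by rewrite cylinder_cons// esum_path_prob ?mule1//; exact: transition_pmf.
apply/seteqP; split => [p px|p /= [px _] i]; first by split => //; exact: px.
by rewrite leqn0 => /eqP->.
Qed.

Lemma cylinder_probS a x k : is_pmf a ->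
  cylinder_prob a x k.+1 =
  (a (x 0%N))%:E * cylinder_prob (transition_prob Q (x 0%N)) (x \o S) k.
Proof.
move=> da; rewrite /cylinder_prob -cylinder_cons//; congr esum.
apply/seteqP; split => [p px|p /= [p0 px]].
  split; first exact: px.
  by move=> i ik; rewrite /= -px//; case: (p) => //; rewrite !onth0n.
case=> // i; rewrite ltnS => /px /= <-.
by case: (p) => //; rewrite !onth0n.
Qed.

(** The Markov property is pushed to the last step by induction on [k], each
first step being moved into the initial distribution. *)
Lemma cylinder_prob_markov a x k : is_pmf a ->
  cylinder_prob a x k.+1 =
  cylinder_prob a x k * (transition_prob Q (x k) (x k.+1))%:E.
Proof.
elim: k a x => [|k IH] a x da.
  rewrite cylinder_probS// !cylinder_prob0//; exact: transition_pmf.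
rewrite cylinder_probS// IH; last exact: transition_pmf.
by rewrite muleA -cylinder_probS.
Qed.

End path_prob.

Lemma esum_probability (R : realType) d (T : measurableType d) (w : T -> R) :
  (forall t, 0 <= w t) -> (\esum_(t in [set: T]) (w t)%:E = 1)%E ->
  exists Pr : probability T R, forall A, Pr A = (\esum_(t in A) (w t)%:E)%E.
Proof.
move=> w0 w1; pose mu (A : set T) : \bar R := (\esum_(t in A) (w t)%:E)%E.
have w0E t : (0 <= (w t)%:E)%E by rewrite lee_fin.
have mu0 : mu set0 = 0%E by exact: esum_set0.
have mu_ge0 A : (0 <= mu A)%E by apply: esum_ge0.
have mu_sigma : semi_sigma_additive mu.
  move=> F mF tF mUF; rewrite /mu nneseries_sum_bigcup//.
  by apply: is_cvg_nneseries => i _ _; exact: mu_ge0.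
pose m := isMeasure.Build d T R mu mu0 mu_ge0 mu_sigma.
pose M : measure T R := HB.pack mu m.
have MT : M [set: T] = 1%E by [].
pose p := Measure_isProbability.Build d T R M MT.
pose Pr : probability T R := HB.pack mu m p.
by exists Pr.
Qed.

(** * Existence of the two chains *)

Section exit_times.
Context {R : realType} {T X : Type}.
Implicit Types (M : nat -> T -> X) (A : set X) (x : nat -> X).

(** Time 0 does not count, as in [exit_time]. *)
Definition exits_at A x (n : nat) :=
  [/\ (1 <= n)%N, ~ A (x n) & forall i, (1 <= i < n)%N -> A (x i)].

Lemma exit_time_eq M A w n : exits_at A (M ^~ w) n ->
  exit_time R M A w = n%:R%:E.
Proof.
move=> [n1 nA before]; apply/eqP; rewrite eq_le; apply/andP; split.
  by apply: ereal_inf_lbound; exists n.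
apply: le_ereal_inf_tmp => _ [m [m1 mA] <-]; rewrite lee_fin ler_nat leqNgt.
by apply/negP => mn; apply: mA; apply: before; rewrite m1.
Qed.

End exit_times.

Lemma E_statesP e s (i : 'I_(e + s)) : E_states (Some i) <-> (i < e)%N.
Proof.
split=> [[j _ [<-]]|ie]; first exact: (ltn_ord j).
by exists (Ordinal ie) => //; congr Some; apply: val_inj.
Qed.

Lemma E_states_lshift e s (i : 'I_e) : E_states (Some (lshift s i)).
Proof. by exists i. Qed.

Lemma E_states_rshift e s (i : 'I_s) : ~ E_states (Some (rshift e i)).
Proof. by case=> j _ /Some_inj/eqP; rewrite eq_lrshift. Qed.

Section existence.
Context {R : realType} {e s : nat}.
Context {alpha : 'rV[R]_e} {P : 'M[R]_e} {U : 'M[R]_(e, s)} {Q1 Q2 : 'M[R]_s}.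
Hypothesis par : CDPH_parameters alpha P U Q1 Q2.

Let B : 'M[R]_(e + s) := block_mx P U 0 Q1.
Let a0 := initial_prob (row_mx alpha (0 : 'rV[R]_s)).

Let B_sub : subprobability_mx B.
Proof.
case: par => _ _ _ _ [P0 _] U0 PU Q1s _ _ _ _.
by apply: subprobability_block_trig => // i; rewrite PU.
Qed.

Let B_eig : eigenvalues_lt1 B.
Proof. by case: par => *; exact: eigenvalues_lt1_block_trig. Qed.

Let a0_pmf : is_pmf a0.
Proof.
have sum1 : \sum_i row_mx alpha (0 : 'rV[R]_s) 0 i = 1.
  rewrite big_split_ord/= [X in _ + X]big1 ?addr0 => [|i _]; last first.
    by rewrite row_mxEr mxE.
  by rewrite -(CDPH_alpha_sum par); apply: eq_bigr => i _; rewrite row_mxEl.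
split=> [[i|]|]; rewrite /a0 /initial_prob ?sum1 ?subrr ?add0r//.
by case: (split_ordP i) => j ->; rewrite ?row_mxEl ?row_mxEr ?mxE// (CDPH_alpha_ge0 par).
Qed.

(** By convention a state of E is sent to [None]; [S_part] is meant for the
state at which a path has just left E. *)
Definition S_part (o : option 'I_(e + s)) : option 'I_s :=
  if o is Some i then (if fintype.split i is inr j then Some j else None) else None.

Lemma S_partK (o : option 'I_s) : S_part (omap (@rshift e s) o) = o.
Proof. by case: o => //= j; rewrite (unsplitK (inr j)). Qed.

(** The time [tau12] of the chain that follows [p] and then terminates: the
search starts after the initial state, hence [behead] and the successor. *)
Definition E_exit (p : seq 'I_(e + s)) : nat :=
  (find (fun i : 'I_(e + s) => (e <= i)%N) (behead p)).+1.

Lemma exits_at_E_exit p : exits_at (@E_states e s) (onth p) (E_exit p).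
Proof.
have onthS i : onth p i.+1 = onth (behead p) i by case: p => //; rewrite !onth0n.
split=> //; rewrite /E_exit.
  rewrite onthS; set q := behead p; case pq : (onth q _) => [i|] => [|[]//].
  move=> /E_statesP; apply/negP; rewrite -leqNgt.
  have fq : (find (fun i : 'I_(e + s) => (e <= i)%N) q < size q)%N.
    by rewrite -onthTE pq.
  rewrite -(onth_nth i _ _ _ pq).
  apply: (@nth_find _ i (fun k : 'I_(e + s) => (e <= k)%N) q).
  by rewrite has_find.
case=> // i /andP[_]; rewrite ltnS onthS; set q := behead p => ifind.
have iq : (i < size q)%N by rewrite (leq_trans ifind)// find_size.
have := iq; rewrite -onthTE; case pq : (onth q i) => [j|]// _.
apply/E_statesP; have := before_find j ifind.
by rewrite (onth_nth j _ _ _ pq) => /negbT; rewrite -ltnNge.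
Qed.

(** The first path is followed by M1 from time 0; the second one is followed by
M2 from time [tau12 + 1] on. *)
Definition trajectories := (seq 'I_(e + s) * seq 'I_s)%type.

HB.instance Definition _ := Choice.on trajectories.
HB.instance Definition _ := isPointed.Build trajectories ([::], [::]).
HB.instance Definition _ := @isMeasurable.Build default_measure_display
  trajectories discrete_measurable discrete_measurable0
  discrete_measurableC discrete_measurableU.

Definition chain1 n (w : trajectories) : option 'I_(e + s) := onth w.1 n.

Definition chain2 n (w : trajectories) : option 'I_(e + s) :=
  if (n <= E_exit w.1)%N then onth w.1 n
  else omap (@rshift e s) (onth w.2 (n - E_exit w.1).-1).

(** M2 makes its first own step from the state in which M1 leaves E. *)
Definition after_exit (p : seq 'I_(e + s)) : option 'I_s -> R :=
  transition_prob Q2 (S_part (onth p (E_exit p))).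

Definition trajectory_prob (w : trajectories) : R :=
  path_prob B a0 w.1 * path_prob Q2 (after_exit w.1) w.2.

Let W1_ge0 p : (0 <= path_prob B a0 p)%R.
Proof. exact: path_prob_ge0. Qed.

Let sQ2 := CDPH_Q2_subprobability par.
Let eQ2 := CDPH_Q2_terminating par.

Let W2_ge0 o q : (0 <= path_prob Q2 (transition_prob Q2 o) q)%R.
Proof. by apply: path_prob_ge0 => //; exact: transition_pmf. Qed.

Let prob_ge0 w : 0 <= trajectory_prob w.
Proof. by rewrite mulr_ge0 ?W1_ge0 ?W2_ge0. Qed.

Let W2_le1 o (C : set (seq 'I_s)) :
  (\esum_(q in C) (path_prob Q2 (transition_prob Q2 o) q)%:E <= 1)%E.
Proof.
rewrite -(esum_path_prob sQ2 eQ2 (transition_pmf sQ2 o)).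
rewrite [leRHS](esumID C); last by move=> q _; rewrite lee_fin.
by rewrite setTI leeDl// esum_ge0// => q _; rewrite lee_fin.
Qed.

(** The second path depends on the first one only through the state in which
the latter leaves E. *)
Let esum_rectangle (A : set (seq 'I_(e + s))) (C : set (seq 'I_s)) o :
  (forall p, A p -> onth p (E_exit p) = o) ->
  (\esum_(w in [set w | A w.1 /\ C w.2]) (trajectory_prob w)%:E =
  (\esum_(p in A) (path_prob B a0 p)%:E) *
  \esum_(q in C) (path_prob Q2 (transition_prob Q2 (S_part o)) q)%:E)%E.
Proof.
move=> Ao.
transitivity (\esum_(p in A) \esum_(q in C) (trajectory_prob (p, q))%:E)%E.
  rewrite esum_esum; last by move=> p q _ _; rewrite lee_fin prob_ge0.
  rewrite (_ : [set w | _] = A `*`` (fun=> C))//.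
set S := (X in (_ * X)%E).
have S0 : (0 <= S)%E by apply: esum_ge0 => q _; rewrite lee_fin.
have S1 : (S <= 1)%E by exact: W2_le1.
have -> : S = (fine S)%:E.
  by rewrite fineK// ge0_fin_numE// (le_lt_trans S1)// ltry.
rewrite muleC -esumZl ?fine_ge0//.
apply: eq_esum => p Ap.
under eq_esum do rewrite /trajectory_prob /= /after_exit (Ao p Ap) EFinM.
rewrite esumZl//; last by move=> q; rewrite lee_fin.
by rewrite muleC fineK// ge0_fin_numE// (le_lt_trans S1)// ltry.
Qed.

Let esum_first (A : set (seq 'I_(e + s))) :
  (\esum_(w in [set w | A w.1]) (trajectory_prob w)%:E =
  \esum_(p in A) (path_prob B a0 p)%:E)%E.
Proof.
transitivity (\esum_(p in A) \esum_(q in setT) (trajectory_prob (p, q))%:E)%E.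
  rewrite esum_esum; last by move=> p q _ _; rewrite lee_fin prob_ge0.
  rewrite (_ : A `*`` (fun=> setT) = [set w : trajectories | A w.1]).
    by apply: eq_esum => -[].
  by apply/seteqP; split => [[p q] []|[p q]].
apply: eq_esum => p _; set o := S_part (onth p (E_exit p)).
rewrite -[RHS]mule1 -(esum_path_prob sQ2 eQ2 (transition_pmf sQ2 o)).
by rewrite -esumZl// => q; rewrite lee_fin W2_ge0.
Qed.

Let total : (\esum_(w in [set: trajectories]) (trajectory_prob w)%:E = 1)%E.
Proof. by rewrite (esum_first setT) esum_path_prob. Qed.

(** Conditionally on the past up to [tau12 = t], which fixes the entrance state
[x t], the two continuations are independent as events about the first and the
second path. This is [esum_rectangle], and it gives at once the Markov property
of M2 and the independence. *)
Lemma CDPH_chains_exist : exists (d : measure_display) (T : measurableType d)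
    (Pr : probability T R) (M1 M2 : nat -> T -> option 'I_(e + s)),
  CDPH_chains alpha P U Q1 Q2 Pr M1 M2.
Proof.
have [Pr PrE] := @esum_probability R _ trajectories trajectory_prob prob_ge0 total.
exists default_measure_display, trajectories, Pr, chain1, chain2.
have tau12E w : tau12 R chain1 w = (E_exit w.1)%:R%:E.
  exact/exit_time_eq/exits_at_E_exit.
have path1 x k : Pr (path_event chain1 x k) = cylinder_prob B a0 x k.
  by rewrite PrE; exact: (esum_first (cylinder x k)).
pose past x t := [set p | E_exit p = t /\ cylinder x t p].
have pastE x t : past_event R chain1 x t = [set w | past x t w.1].
  apply/seteqP; split => w [wt wx]; split => //.
    by move: wt; rewrite /= tau12E => -[/eqP]; rewrite eqr_nat => /eqP.
  by rewrite /= tau12E wt.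
have past_o x t p : past x t p -> onth p (E_exit p) = x t.
  by move=> [pt px]; rewrite pt px.
have chain2_shift x t i w : past x t w.1 -> shift_time t chain2 i w =
    if i is j.+1 then omap (@rshift e s) (onth w.2 j) else x t.
  move=> wp; rewrite /shift_time /chain2; case: (wp) => -> _.
  case: i => [|i]; first by rewrite addn0 leqnn; have [_ ->] := wp.
  by rewrite addnS ltnNge leq_addr/= -addnS addKn.
split => //.
- move=> x.
  rewrite -(cylinder_prob0 B_sub B_eig (fun=> x) a0_pmf) -path1.
  by congr (Pr _); apply/seteqP; split => [w ? i|w /(_ 0%N)];
    rewrite ?leqn0; [move=> /eqP ->|apply].
- by move=> x k; rewrite !path1 cylinder_prob_markov.
- by move=> n w; rewrite tau12E lee_fin ler_nat /chain2 => ->.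
- move=> x t y k /=; set F := past_event _ _ _ _; set N2 := shift_time _ _.
  set z := fun i => _.
  (* M2 starts its S-phase at x t, so no other z 0 is possible on F. *)
  have [z0|z0] := eqVneq (z 0%N) (x t); last first.
    have F0 k' : F `&` path_event N2 z k' = set0.
      apply/seteqP; split => // w []; rewrite /F pastE => wF /(_ 0%N (leq0n _)).
      by rewrite /N2 (chain2_shift _ _ _ _ wF) => xz; rewrite -xz eqxx in z0.
    by rewrite !F0 measure0 mul0e.
  pose C k' := [set q : seq 'I_s | forall i, (i < k')%N -> onth q i = y i.+1].
  have FE k' : F `&` path_event N2 z k' = [set w | past x t w.1 /\ C k' w.2].
    rewrite /F pastE; apply/seteqP; split => w [wF wz]; split => // -[|i] ik.
    + have := wz 1%N ik; rewrite /N2 (chain2_shift _ _ _ _ wF) /z.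
      by move/(congr1 S_part); rewrite !S_partK.
    + have := wz i.+2 ik; rewrite /N2 (chain2_shift _ _ _ _ wF) /z.
      by move/(congr1 S_part); rewrite !S_partK.
    + by rewrite /N2 (chain2_shift _ _ _ _ wF).
    + by rewrite /N2 (chain2_shift _ _ _ _ wF) /z wz.
  rewrite !FE !PrE !(esum_rectangle _ (past_o x t)) -z0 S_partK -muleA.
  congr (_ * _)%E.
  have CS k' : C k'.+1 = cylinder (y \o S) k' by [].
  rewrite CS; case: k => [|k].
    rewrite (_ : C 0%N = setT); last by apply/seteqP; split.
    rewrite esum_path_prob//; last exact: transition_pmf.
    rewrite mul1e -[LHS]/(cylinder_prob _ _ _ _) cylinder_prob0//.
    exact: transition_pmf.
  rewrite CS -!/(cylinder_prob _ _ _ _) cylinder_prob_markov//.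
  exact: transition_pmf.
- move=> x t y1 y2 k1 k2 /=; set F := past_event _ _ _ _.
  pose A := [set p | past x t p /\
    forall i, (i <= k1)%N -> onth p (t + i)%N = y1 i].
  pose C := [set q : seq 'I_s | x t = y2 0%N /\
    forall i, (i < k2)%N -> omap (@rshift e s) (onth q i) = y2 i.+1].
  have FE : F = [set w | past x t w.1 /\ setT w.2].
    by rewrite /F pastE; apply/seteqP; split => // w [].
  have F1 : F `&` path_event (shift_time t chain1) y1 k1 =
      [set w | A w.1 /\ setT w.2].
    by rewrite /F pastE; apply/seteqP; split => [w []|w [[]]].
  have C2 w : past x t w.1 ->
      path_event (shift_time t chain2) y2 k2 w <-> C w.2.
    move=> wF; split => [wy|[y0 wy] [|i] ik].
    + split=> [|i ik].
        by have := wy 0%N (leq0n _); rewrite (chain2_shift _ _ _ _ wF).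
      by have := wy i.+1 ik; rewrite (chain2_shift _ _ _ _ wF).
    + by rewrite (chain2_shift _ _ _ _ wF).
    + by rewrite (chain2_shift _ _ _ _ wF) wy.
  have F2 : F `&` path_event (shift_time t chain2) y2 k2 =
      [set w | past x t w.1 /\ C w.2].
    rewrite /F pastE; apply/seteqP; split => w [wF w2]; split => //.
      exact/C2.
    exact/C2.
  have F12 : F `&` path_event (shift_time t chain1) y1 k1
      `&` path_event (shift_time t chain2) y2 k2 = [set w | A w.1 /\ C w.2].
    rewrite F1; apply/seteqP; split => w /=.
      by case=> [[[wF wA] _] w2]; split => //; apply/C2.
    by case=> [[wF wA] w2]; split => //; apply/C2.
  have A_o p : A p -> onth p (E_exit p) = x t by move=> [/past_o].
  rewrite F12 F1 F2 FE !PrE.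
  rewrite !(esum_rectangle _ (past_o x t)) !(esum_rectangle _ A_o).
  rewrite esum_path_prob//; last exact: transition_pmf.
  by rewrite !mule1 -!muleA [X in (_ * X)%E]muleC.
Qed.

End existence.

(** * Countable partitions and measurability of exit times *)

Section partition.
Local Open Scope ereal_scope.
Context {R : realType} {d : measure_display} {T : measurableType d}.
Variable Pr : probability T R.

Lemma measure_countable_bigcup (I : countType) (H : I -> set T) :
  (forall i, measurable (H i)) -> trivIset setT H ->
  measurable (\bigcup_i H i) /\ Pr (\bigcup_i H i) = \esum_(i in [set: I]) Pr (H i).
Proof.
move=> mH tH.
pose F n : set T := if @pickle_inv I n is Some i then H i else set0.
have mF n : measurable (F n) by rewrite /F; case: pickle_inv.
have tF : trivIset setT F.
  move=> m n _ _; rewrite /F.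
  case im : (pickle_inv m) => [i|]; last by case=> w [].
  case jn : (pickle_inv n) => [j|]; last by case=> w [].
  move=> /tH ij; have := @pickle_invK I m; have := @pickle_invK I n.
  by rewrite im jn /= ij// => -> ->.
have UF : \bigcup_i H i = \bigcup_n F n.
  apply/seteqP; split => w [k _].
    by move=> Hk; exists (pickle k) => //; rewrite /F pickleK_inv.
  by rewrite /F; case: pickle_inv => // i Hi; exists i.
split; first by rewrite UF; exact: bigcupT_measurable.
rewrite UF measure_semi_bigcup//; last exact: bigcupT_measurable.
rewrite nneseries_esumT//.
rewrite (esumID (range (@pickle I)))//= setTI [X in _ + X]esum1 ?adde0.
  rewrite esum_image; last by move=> i j _ _; apply: pcan_inj (@pickleK_inv I) _ _.
  by apply: eq_esum => i _; rewrite /F pickleK_inv.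
move=> n [_ nr]; rewrite /F; case jn : (pickle_inv n) => [j|]//.
by case: nr; exists j => //; have := @pickle_invK I n; rewrite jn.
Qed.

(** Countably many disjoint events of total probability 1 miss a null set. *)
Lemma probability_partition (I : countType) (H : I -> set T) (B : set T) :
  (forall i, measurable (H i)) -> trivIset setT H ->
  \esum_(i in [set: I]) Pr (H i) = 1 -> measurable B ->
  Pr B = \esum_(i in [set: I]) Pr (B `&` H i).
Proof.
move=> mH tH H1 mB; have [mU UE] := measure_countable_bigcup mH tH.
have [] := @measure_countable_bigcup I (fun i => B `&` H i).
- by move=> i; exact: measurableI.
- by apply: trivIset_setIl.
rewrite -setI_bigcupr => mBU <-.
have UC : Pr (~` (\bigcup_i H i)) = 0.
  by rewrite probability_setC// UE H1 subee.
have null : Pr (B `&` ~` (\bigcup_i H i)) = 0.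
  apply: (@subset_measure0 _ _ _ Pr _ (~` (\bigcup_i H i))) => //.
  - by apply: measurableI => //; exact: measurableC.
  - exact: measurableC.
rewrite -[in LHS](setIT B) -(setUv (\bigcup_i H i)) setIUr measureU//.
- by rewrite [X in (_ + X)%R](null : _ = _) adde0.
- by apply: measurableI => //; exact: measurableC.
- by rewrite setIACA setIid setICr setI0.
Qed.

End partition.

Section exit_time_measurable.
Context {R : realType} {d : measure_display} {T : measurableType d} {n : nat}.
Variable M : nat -> T -> option 'I_n.
Hypothesis mM : forall k x, measurable [set w | M k w = x].

Lemma measurable_state k (A : set (option 'I_n)) : measurable [set w | A (M k w)].
Proof.
rewrite (_ : [set w | _] = \bigcup_(x in A) [set w | M k w = x]); last first.
  by apply/seteqP; split => [w Aw|w [x Ax] /= ->]; first exists (M k w).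
by apply: fin_bigcup_measurable => //; exact: finite_finset.
Qed.

Lemma measurable_path_event x k : measurable (path_event M x k).
Proof.
rewrite (_ : path_event M x k = \bigcap_(i in `I_k.+1) [set w | M i w = x i]).
  by apply: bigcap_measurable => [|i _]; [exists 0%N|exact: mM].
by apply/seteqP; split.
Qed.

(** The infimum is smaller than a given value if and only if the chain is outside [A]
at some time [k >= 1] smaller than this value. *)
Lemma measurable_exit_time A : measurable_fun setT (exit_time R M A).
Proof.
apply: (measurability _ (ErealGenInftyO.measurableE R)) => _ [_ [x ->] <-].
rewrite setTI.
rewrite (_ : _ @^-1` _ = \bigcup_(k in [set k | (1 <= k)%N /\ (k%:R < x)%R])
    [set w | (~` A) (M k w)]); last first.
  apply/seteqP; split => w /=; rewrite in_itv/=.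
    move=> /ereal_inf_lt[_ [k [k1 kA] <-]]; rewrite lte_fin => kx.
    by exists k.
  move=> [k [k1 kx] kA]; apply: (@le_lt_trans _ _ k%:R%:E); last by rewrite lte_fin.
  by apply: ereal_inf_lbound; exists k.
by apply: bigcup_measurable => k _; exact: measurable_state.
Qed.

End exit_time_measurable.

(** * The law computed from the parameters *)

Section mean.
Local Open Scope ereal_scope.
Context {R : realType} {e s : nat}.

(** The probability that the chain enters S at time [t + 1] and in state [k]. *)
Definition hit_prob (alpha : 'rV[R]_e) (P : 'M[R]_e) (U : 'M[R]_(e, s)) t k : R :=
  (alpha *m power_apply P t U) 0%R k.

(** The probability that the chain with matrix [Q] started at [k] terminates at
time [a + 1]. *)
Definition exit_prob n (Q : 'M[R]_n) k a : R := power_apply Q a (exit_cV Q) k 0%R.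

Variables (alpha : 'rV[R]_e) (P : 'M[R]_e) (U : 'M[R]_(e, s)) (Q1 Q2 : 'M[R]_s).

(** The expectation of [g] at the pair of termination times. The second
successors account for the two shifts of [hit_prob] and [exit_prob]. *)
Definition cdph_mean (g : nat -> nat -> \bar R) : \bar R :=
  \esum_(t in [set: nat]) \esum_(k in [set: 'I_s])
    ((hit_prob alpha P U t k)%:E *
     \esum_(a in [set: nat]) ((exit_prob Q1 k a)%:E *
     \esum_(b in [set: nat]) ((exit_prob Q2 k b)%:E *
       g (t + a).+2 (t + b).+2))).

Hypothesis par : CDPH_parameters alpha P U Q1 Q2.

Lemma hit_prob_ge0 t k : (0 <= hit_prob alpha P U t k)%R.
Proof.
rewrite /hit_prob mxE sumr_ge0// => i _; rewrite mulr_ge0 ?(CDPH_alpha_ge0 par)//.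
apply: power_apply_ge0; [exact: (CDPH_P_subprobability par).1|].
exact: (CDPH_U_ge0 par).
Qed.

Lemma exit_prob_ge0 n (Q : 'M[R]_n) k a : subprobability_mx Q ->
  (0 <= exit_prob Q k a)%R.
Proof.
move=> sQ; apply: power_apply_ge0 => [|i j]; first exact: sQ.1.
by rewrite ord1 exit_cV_ge0.
Qed.

Lemma exit_cV_P : exit_cV P = U *m (const_mx 1%R : 'cV[R]_s).
Proof.
apply/matrixP => i j; rewrite ord1 exit_cVE.
rewrite -[X in (X - _)%R](CDPH_PU_sum par i) big_split_ord/= mxE.
under eq_bigr do rewrite row_mxEl.
rewrite addrC addrK; apply: eq_bigr => k _.
by rewrite row_mxEr [X in _ = (_ * X)%R]mxE mulr1.
Qed.

(** The two remaining times are finite by termination. The entrance time is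
the termination time of the chain with matrix [P], as [U 1] is its exit vector,
hence finite for the same reason. *)
Lemma cdph_mean1 : cdph_mean (fun _ _ => 1) = 1.
Proof.
rewrite /cdph_mean.
transitivity (\esum_(t in [set: nat]) \esum_(i in [set: 'I_e])
    ((alpha 0%R i)%:E * (exit_prob P i t)%:E)).
  apply: eq_esum => t _.
  rewrite [LHS](_ : _ = \esum_(k in [set: 'I_s]) (hit_prob alpha P U t k)%:E).
    rewrite !esum_finType; first last.
    - by move=> k; rewrite lee_fin hit_prob_ge0.
    - move=> i; rewrite -EFinM lee_fin mulr_ge0 ?(CDPH_alpha_ge0 par)//.
      exact: exit_prob_ge0 (CDPH_P_subprobability par).
    rewrite !sumEFin; congr EFin.
    transitivity ((alpha *m power_apply P t (exit_cV P)) 0%R 0%R).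
      rewrite exit_cV_P power_apply_mul mulmxA mxE.
      by apply: eq_bigr => k _; rewrite [const_mx _ _ _]mxE mulr1.
    by rewrite mxE.
  apply: eq_esum => k _.
  have r1 (Q : 'M[R]_s) : subprobability_mx Q -> eigenvalues_lt1 Q ->
      \esum_(a in [set: nat]) (exit_prob Q k a)%:E = 1.
    exact: esum_exit.
  under [in LHS]eq_esum => a _.
    under eq_esum do rewrite mule1.
    rewrite (r1 _ (CDPH_Q2_subprobability par) (CDPH_Q2_terminating par)) mule1; over.
  by rewrite (r1 _ (CDPH_Q1_subprobability par) (CDPH_Q1_terminating par)) mule1.
have sP := CDPH_P_subprobability par.
rewrite exchange_esum; last first.
  by move=> t i; rewrite -EFinM lee_fin mulr_ge0 ?(CDPH_alpha_ge0 par)// exit_prob_ge0.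
transitivity (\esum_(i in [set: 'I_e]) (alpha 0%R i)%:E).
  apply: eq_esum => i _; rewrite esumZl ?(CDPH_alpha_ge0 par)//; last first.
    by move=> t; rewrite lee_fin exit_prob_ge0.
  by rewrite (esum_exit _ sP (CDPH_P_terminating par)) mule1.
rewrite esum_finType ?sumEFin ?(CDPH_alpha_sum par)//.
by move=> i; rewrite lee_fin (CDPH_alpha_ge0 par).
Qed.

(** A finite history [(k, (i, (xs, (y1, y2))))]: the common part visits [i] and
then [xs] in E and enters S at [k]; from there M1 and M2 visit [y1] and [y2],
respectively, before they terminate. *)
Definition history :=
  ('I_s * ('I_e * (seq 'I_e * (seq 'I_s * seq 'I_s))))%type.

Definition history_prob (h : history) : R :=
  let: (k, (i, (xs, (y1, y2)))) := h in
  (alpha 0 i * walk_weight P (col k U) i xs *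
   walk_weight Q1 (exit_cV Q1) k y1 * walk_weight Q2 (exit_cV Q2) k y2)%R.

Definition history_tau1 (h : history) : nat :=
  let: (k, (i, (xs, (y1, y2)))) := h in (size xs + size y1).+2.

Definition history_tau2 (h : history) : nat :=
  let: (k, (i, (xs, (y1, y2)))) := h in (size xs + size y2).+2.

(** Each of the three walks of a history is summed by its length, innermost
first. *)
Lemma esum_history (g : nat -> nat -> \bar R) : (forall m n, 0 <= g m n) ->
  \esum_(h in [set: history])
    ((history_prob h)%:E * g (history_tau1 h) (history_tau2 h)) = cdph_mean g.
Proof.
move=> g0.
have [sP [sQ1 sQ2]] := (CDPH_P_subprobability par,
  (CDPH_Q1_subprobability par, CDPH_Q2_subprobability par)).
have al0 := CDPH_alpha_ge0 par.
have w1 k p := walk_exit_ge0 sQ1 k p.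
have w2 k p := walk_exit_ge0 sQ2 k p.
have uk0 (k : 'I_s) j : (0 <= (col k U) j 0)%R by rewrite mxE (CDPH_U_ge0 par).
have wP k i xs : (0 <= walk_weight P (col k U) i xs)%R.
  by apply: walk_weight_ge0; [exact: sP.1|exact: uk0].
have q0 (Q : 'M[R]_s) : subprobability_mx Q -> forall j, (0 <= exit_cV Q j 0)%R.
  by move=> sQ j; exact: exit_cV_ge0.
pose F k i xs y1 y2 := (alpha 0%R i)%:E * ((walk_weight P (col k U) i xs)%:E *
  ((walk_weight Q1 (exit_cV Q1) k y1)%:E *
  ((walk_weight Q2 (exit_cV Q2) k y2)%:E *
     g (size xs + size y1).+2 (size xs + size y2).+2))).
have F0 k i xs y1 y2 : 0 <= F k i xs y1 y2.
  by rewrite /F !mule_ge0// lee_fin.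
transitivity (\esum_(k in [set: 'I_s]) \esum_(i in [set: 'I_e])
    \esum_(xs in [set: seq 'I_e]) \esum_(y1 in [set: seq 'I_s])
    \esum_(y2 in [set: seq 'I_s]) F k i xs y1 y2).
  under [RHS]eq_esum => k _.
    under eq_esum => i _.
      under eq_esum => xs _ do rewrite esum_pair//.
      rewrite esum_pair//; over.
    rewrite esum_pair; last by [].
    over.
  rewrite esum_pair//; apply: eq_esum => -[k [i [xs [y1 y2]]]] _ /=.
  by rewrite /F !EFinM !muleA.
pose G2 k m a := \esum_(b in [set: nat]) ((exit_prob Q2 k b)%:E *
  g (m + a).+2 (m + b).+2).
have G20 k m a : 0 <= G2 k m a.
  by apply: esum_ge0 => b _; rewrite mule_ge0// lee_fin exit_prob_ge0.
pose G1 k m := \esum_(a in [set: nat]) ((exit_prob Q1 k a)%:E * G2 k m a).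
have G10 k m : 0 <= G1 k m.
  by apply: esum_ge0 => b _; rewrite mule_ge0// lee_fin exit_prob_ge0.
rewrite /cdph_mean [RHS]exchange_esum; last first.
  by move=> t k; rewrite mule_ge0 ?lee_fin ?hit_prob_ge0//; exact: G10.
apply: eq_esum => k _.
transitivity (\esum_(i in [set: 'I_e]) ((alpha 0%R i)%:E *
    \esum_(t in [set: nat]) ((power_apply P t (col k U) i 0%R)%:E * G1 k t))).
  apply: eq_esum => i _; rewrite -esum_walk//; last exact: sP.1.
  rewrite -esumZl//; last by move=> xs; rewrite mule_ge0// lee_fin.
  apply: eq_esum => xs _; rewrite /F.
  rewrite /G1 -(esum_walk _ sQ1.1 (q0 _ sQ1))//.
  rewrite -esumZl//; last by move=> y; rewrite mule_ge0// lee_fin.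
  rewrite -esumZl//; last by move=> y; rewrite !mule_ge0// lee_fin.
  apply: eq_esum => y1 _.
  rewrite /G2 -(esum_walk
    (h := fun b => g (size xs + size y1).+2 (size xs + b).+2)
    _ sQ2.1 (q0 _ sQ2))//.
  rewrite -esumZl//; last by move=> y; rewrite mule_ge0// lee_fin.
  rewrite -esumZl//; last by move=> y; rewrite !mule_ge0// lee_fin.
  by rewrite -esumZl//; move=> y; rewrite !mule_ge0// lee_fin.
have pP t j (l : 'I_1) : (0 <= power_apply P t (col k U) j l)%R.
  by apply: power_apply_ge0 => [|? m]; [exact: sP.1|rewrite (ord1 m)].
transitivity (\esum_(i in [set: 'I_e]) \esum_(t in [set: nat])
    ((alpha 0%R i)%:E * ((power_apply P t (col k U) i 0%R)%:E * G1 k t))).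
  apply: eq_esum => i _; rewrite esumZl// => t.
  by rewrite mule_ge0// lee_fin.
rewrite exchange_esum; last by move=> i t; rewrite !mule_ge0// lee_fin.
apply: eq_esum => t _.
rewrite esum_finType; last by move=> i; rewrite !mule_ge0// lee_fin.
rewrite -[RHS]/((hit_prob alpha P U t k)%:E * G1 k t).
rewrite /hit_prob mxE -sumEFin ge0_sume_distrl; last first.
  move=> i _; rewrite lee_fin mulr_ge0//; apply: power_apply_ge0; first exact: sP.1.
  exact: (CDPH_U_ge0 par).
apply: eq_bigr => i _; rewrite muleA -EFinM; congr ((_ * _)%:E * _).
have -> : col k U = U *m delta_mx k 0%R by rewrite colE.
by rewrite power_apply_mul -colE mxE.
Qed.

End mean.

(** * The law of given chains *)

Section onth_facts.

Lemma onth_map (S T : Type) (f : S -> T) (p : seq S) n :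
  onth (map f p) n = omap f (onth p n).
Proof. by elim: p n => [|x p IH] [|n] /=. Qed.

Lemma onth_cat_ge (T : Type) (p q : seq T) n :
  onth (p ++ q) (size p + n) = onth q n.
Proof. by rewrite onth_cat ltnNge leq_addr/= addKn. Qed.

(** The value [None] just after the end of a list marks its length. *)
Lemma onth_size_inj (T : eqType) (p q : seq T) :
  (forall n, (n <= size p)%N -> (n <= size q)%N -> onth p n = onth q n) -> p = q.
Proof.
move=> pq; have le (u v : seq T) : 
    (forall n, (n <= size u)%N -> (n <= size v)%N -> onth u n = onth v n) ->
    (size u <= size v)%N -> (size v <= size u)%N.
  move=> uv; rewrite leq_eqVlt => /predU1P[->//|lt].
  have := uv _ (leqnn _) (ltnW lt); rewrite onth_default// => vu.
  by move: lt; rewrite -onthTE -vu.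
have eqs : size p = size q.
  case/orP: (leq_total (size p) (size q)) => pq_le; apply/eqP;
    rewrite eqn_leq pq_le ?andbT/=.
    exact: le pq pq_le.
  by apply: le pq_le => n nq np; rewrite pq.
apply: eq_from_onth_le => n; rewrite eqs maxnn => nq.
by rewrite pq ?eqs// ltnW.
Qed.

End onth_facts.

Section transitions.
Context {R : realType} {e s : nat}.
Variables (P : 'M[R]_e) (U : 'M[R]_(e, s)) (Q : 'M[R]_s).
Local Notation B := (block_mx P U 0 Q).

Lemma transition_S (o o' : option 'I_s) :
  transition_prob B (omap (@rshift e s) o) (omap (@rshift e s) o') =
  transition_prob Q o o'.
Proof.
case: o o' => [k|] [l|] //=; first by rewrite block_mxEdr.
congr (_ - _); rewrite big_split_ord/= big1 ?add0r => [|i _].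
  by apply: eq_bigr => l _; rewrite block_mxEdr.
by rewrite block_mxEdl mxE.
Qed.

Lemma prod_transition_walk n (M : 'M[R]_n) k p :
  \prod_(l < (size p).+1)
    transition_prob M (onth (k :: p) l) (onth (k :: p) l.+1) =
  walk_weight M (exit_cV M) k p.
Proof.
elim: p k => [|j p IH] k; first by rewrite big_ord1 /= exit_cVE.
by rewrite big_ord_recl /= -IH.
Qed.

(** The last of the [size xs + 1] steps leaves the E-part and enters S at [k],
whatever [q] follows. *)
Lemma prod_transition_entrance i xs k q :
  \prod_(l < (size xs).+1)
    transition_prob B
      (onth (map (@lshift e s) (i :: xs) ++ map (@rshift e s) (k :: q)) l)
      (onth (map (@lshift e s) (i :: xs) ++ map (@rshift e s) (k :: q)) l.+1) =
  walk_weight P (col k U) i xs.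
Proof.
elim: xs i => [|j xs IH] i.
  by rewrite big_ord1 /= block_mxEur mxE.
by rewrite big_ord_recl /= block_mxEul -IH.
Qed.

End transitions.

Section chain_law.
Context {R : realType} {e s : nat}.
Context {alpha : 'rV[R]_e} {P : 'M[R]_e} {U : 'M[R]_(e, s)} {Q1 Q2 : 'M[R]_s}.
Hypothesis par : CDPH_parameters alpha P U Q1 Q2.
Context {d : measure_display} {T : measurableType d} {Pr : probability T R}.
Context {M1 M2 : nat -> T -> option 'I_(e + s)}.
Hypothesis chains : CDPH_chains alpha P U Q1 Q2 Pr M1 M2.

Section one_history.
Variable h : @history e s.
Let k := h.1.
Let i := h.2.1.
Let xs := h.2.2.1.
Let y1 := h.2.2.2.1.
Let y2 := h.2.2.2.2.
Let t := (size xs).+1.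
(* The whole path of M1, and the path of M2 from time t on. *)
Let x := onth (map (@lshift e s) (i :: xs) ++ map (@rshift e s) (k :: y1)).
Let z := fun n => omap (@rshift e s) (onth (k :: y2) n).

Let x_E n : (n < t)%N -> x n = omap (@lshift e s) (onth (i :: xs) n).
Proof. by move=> nt; rewrite /x onth_cat size_map nt onth_map. Qed.

Let x_S n : x (t + n)%N = omap (@rshift e s) (onth (k :: y1) n).
Proof.
have -> : t = size (map (@lshift e s) (i :: xs)) by rewrite size_map.
by rewrite /x onth_cat_ge onth_map.
Qed.

Let F := past_event R M1 x t.
Let A1 := path_event (shift_time t M1) (fun n => x (t + n)%N) (size y1).+1.
Let A2 := path_event (shift_time t M2) z (size y2).+1.

Definition history_event : set T := F `&` A1 `&` A2.

Let x_exits (w : T) : path_event M1 x t w -> exits_at (@E_states e s) (M1 ^~ w) t.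
Proof.
move=> wx; split => //.
  rewrite wx// -[t in x t]addn0 x_S /=; exact: E_states_rshift.
move=> n /andP[_ nt]; rewrite wx ?(ltnW nt)// x_E//.
have : onth (i :: xs) n by rewrite onthTE.
by case: onth => // j _; exact: E_states_lshift.
Qed.

(** The path itself tells that it leaves E at time [t]. *)
Let FE : F = path_event M1 x t.
Proof.
apply/seteqP; split => [w []//|w wx]; split => //.
exact/exit_time_eq/x_exits.
Qed.

Let FA1E n : F `&` path_event (shift_time t M1) (fun n => x (t + n)%N) n =
  path_event M1 x (t + n).
Proof.
rewrite FE; apply/seteqP; split => w.
  move=> [wt wn] l ltn; have [lt|/ltnW tl] := leqP l t; first exact: wt.
  by have := wn (l - t)%N; rewrite leq_subLR /shift_time subnKC// => /(_ ltn).
move=> wtn; split => l ln; apply: wtn; first exact: leq_trans ln (leq_addr _ _).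
by rewrite leq_add2l.
Qed.

Let path_event_x n : Pr (path_event M1 x n) =
  (alpha 0 i * \prod_(l < n) transition_prob (block_mx P U 0 Q1) (x l) (x l.+1))%:E.
Proof.
elim: n => [|n IH].
  rewrite big_ord0 mulr1 (_ : path_event M1 x 0 = [set w | M1 0%N w = x 0%N]).
    by rewrite (CDPH_M1_initial chains) x_E//= row_mxEl.
  apply/seteqP; split => [w /(_ 0%N)/(_ isT)//|w wx l].
  by rewrite leqn0 => /eqP ->.
by rewrite (CDPH_M1_markov chains) IH big_ord_recr/= mulrA EFinM.
Qed.

Let PrF : Pr F = (alpha 0 i * walk_weight P (col k U) i xs)%:E.
Proof. by rewrite FE path_event_x prod_transition_entrance. Qed.

Let PrFA1 : Pr (F `&` A1) = (Pr F * (walk_weight Q1 (exit_cV Q1) k y1)%:E)%E.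
Proof.
rewrite FA1E FE !path_event_x big_split_ord/= mulrA EFinM; congr (_ * _%:E)%E.
rewrite -prod_transition_walk; apply: eq_bigr => l _.
by rewrite -addnS !x_S transition_S.
Qed.

Let FA2_path n : Pr (F `&` path_event (shift_time t M2) z n) =
  (Pr F * (\prod_(l < n) transition_prob Q2 (onth (k :: y2) l)
                                   (onth (k :: y2) l.+1))%:E)%E.
Proof.
elim: n => [|n IH].
  rewrite big_ord0 mule1; congr (Pr _); apply/seteqP; split => [w []//|w wF].
  split=> // l; rewrite leqn0 => /eqP ->; have [tw wx] := wF.
  rewrite /shift_time addn0 (CDPH_M2_before chains); last by rewrite -tw.
  by rewrite wx// -[t in x t]addn0 x_S.
by rewrite (CDPH_M2_markov chains x t) IH big_ord_recr/= EFinM muleA.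
Qed.

Let PrFA2 : Pr (F `&` A2) = (Pr F * (walk_weight Q2 (exit_cV Q2) k y2)%:E)%E.
Proof. by rewrite FA2_path prod_transition_walk. Qed.

Lemma history_event_measurable : measurable history_event.
Proof.
apply: measurableI.
  by rewrite FA1E; apply: measurable_path_event (CDPH_M1_measurable chains) _ _.
by apply: measurable_path_event => n o; exact: (CDPH_M2_measurable chains).
Qed.

(** Given [F], the continuations of M1 and M2 are Markov chains with matrices
[Q1] and [Q2] from the entrance state, and independent. The independence is a
product formula with a factor [Pr F], which cancels unless it is 0; in that case
the event is null as well. *)
Lemma history_event_prob :
  Pr history_event = (history_prob alpha P U Q1 Q2 h)%:E.
Proof.
have -> : history_prob alpha P U Q1 Q2 h =
    alpha 0 i * walk_weight P (col k U) i xs *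
    walk_weight Q1 (exit_cV Q1) k y1 * walk_weight Q2 (exit_cV Q2) k y2.
  by rewrite /history_prob /k /i /xs /y1 /y2; case: (h) => ? [? [? []]].
rewrite !EFinM -EFinM -PrF -PrFA1.
have := CDPH_M2_independent chains x t (fun n => x (t + n)%N) z
  (size y1).+1 (size y2).+1; rewrite -/F -/A1 -/A2 -/history_event /= => ind.
have mF : measurable F.
  by rewrite FE; apply: measurable_path_event (CDPH_M1_measurable chains) _ _.
have mH := history_event_measurable.
have [PF0|PF0] := eqVneq (alpha 0 i * walk_weight P (col k U) i xs) 0.
  rewrite PrFA1 PrF PF0 !mul0e; apply: (@subset_measure0 _ _ _ Pr _ F) => //.
    by move=> w [[]].
  by have := PrF; rewrite PF0.
move: ind; rewrite PrFA2 [RHS]muleA [RHS]muleAC PrF.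
move=> /(congr1 (fun u =>
  u * (alpha 0 i * walk_weight P (col k U) i xs)^-1%:E)%E).
by rewrite -!muleA -EFinM divff// !mule1.
Qed.

Lemma history_event_tau1 w : history_event w ->
  tau R M1 w = (history_tau1 h)%:R%:E.
Proof.
have -> : history_tau1 h = (t + (size y1).+1)%N.
  by rewrite addnS /history_tau1 /t /xs /y1; case: (h) => ? [? [? []]].
rewrite /history_event FA1E => -[wx _].
apply: exit_time_eq; split; first by rewrite addnS.
  rewrite wx// x_S onth_default//=; by case.
move=> n /andP[_ nt]; rewrite wx ?(ltnW nt)//.
have : x n by rewrite /x onthTE size_cat !size_map.
by case: (x n) => // j _; exists j.
Qed.

Lemma history_event_tau12 w : history_event w -> tau12 R M1 w = t%:R%:E.
Proof. by move=> [[[]]]. Qed.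

Lemma history_event_tau2 w : history_event w ->
  tau R M2 w = (history_tau2 h)%:R%:E.
Proof.
have -> : history_tau2 h = (t + (size y2).+1)%N.
  by rewrite addnS /history_tau2 /t /xs /y2; case: (h) => ? [? [? []]].
move=> [[[tw wx] _] wz].
apply: exit_time_eq; split; first by rewrite addnS.
  have := wz (size y2).+1 (leqnn _); rewrite /shift_time => ->.
  by rewrite /z onth_default//=; case.
move=> n /andP[_ nt]; have [ltn|tn] := ltnP n t.
  rewrite (CDPH_M2_before chains); last by rewrite tw lee_fin ler_nat ltnW.
  rewrite wx ?(ltnW ltn)// x_E//.
  have : onth (i :: xs) n by rewrite onthTE.
  by case: onth => // j _; exists (lshift s j).
rewrite -(subnKC tn); have := wz (n - t)%N; rewrite /shift_time => ->; last first.
  by rewrite leq_subLR ltnW.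
have : onth (k :: y2) (n - t)%N by rewrite onthTE/= ltn_subLR.
by rewrite /z; case: onth => // j _; exists (rshift e j).
Qed.

Lemma history_event_M1_before w n : history_event w -> (n < t)%N ->
  M1 n w = omap (@lshift e s) (onth (i :: xs) n).
Proof. by move=> [[[_ wx] _] _] nt; rewrite wx ?x_E// ltnW. Qed.

Lemma history_event_M1_after w n : history_event w -> (n <= (size y1).+1)%N ->
  M1 (t + n)%N w = omap (@rshift e s) (onth (k :: y1) n).
Proof. by move=> [[_ w1] _] n1; rewrite -x_S -w1. Qed.

Lemma history_event_M2_after w n : history_event w -> (n <= (size y2).+1)%N ->
  M2 (t + n)%N w = omap (@rshift e s) (onth (k :: y2) n).
Proof. by move=> [_ w2] n2; have := w2 n n2. Qed.

End one_history.

(** A trajectory reveals its history: [tau12] gives the length of the common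
part, and each continuation ends at the first [None]. *)
Lemma history_event_inj h h' w : history_event h w -> history_event h' w -> h = h'.
Proof.
move=> wh wh'.
have sz : size h.2.2.1 = size h'.2.2.1.
  have := history_event_tau12 wh; rewrite (history_event_tau12 wh').
  by move=> [/eqP]; rewrite eqr_nat => /eqP [].
have linj : injective (omap (@lshift e s)).
  by move=> [a|] [b|] //= /Some_inj/lshift_inj ->.
have rinj : injective (omap (@rshift e s)).
  by move=> [a|] [b|] //= /Some_inj/rshift_inj ->.
have E1 : h.2.1 :: h.2.2.1 = h'.2.1 :: h'.2.2.1.
  apply: eq_from_onth_le => n; rewrite /= sz maxnn => nt; apply: linj.
  by rewrite -(history_event_M1_before wh) ?sz// (history_event_M1_before wh').
have E2 : h.1 :: h.2.2.2.1 = h'.1 :: h'.2.2.2.1.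
  apply: onth_size_inj => n nh nh'; apply: rinj.
  by rewrite -(history_event_M1_after wh)// -(history_event_M1_after wh') ?sz.
have E3 : h.1 :: h.2.2.2.2 = h'.1 :: h'.2.2.2.2.
  apply: onth_size_inj => n nh nh'; apply: rinj.
  by rewrite -(history_event_M2_after wh)// -(history_event_M2_after wh') ?sz.
case: h h' E1 E2 E3 {wh wh' sz} => [k [i [xs [y1 y2]]]] [k' [i' [xs' [y1' y2']]]].
by move=> /= [-> ->] [-> ->] [->].
Qed.

(** On the event of a history both termination times are constant, and these
events form a partition up to a null set because [cdph_mean1] is the sum of
their probabilities. *)
Lemma chains_law (A : set (\bar R * \bar R)) : measurable A ->
  pushforward Pr (fun w => (tau R M1 w, tau R M2 w)) A =
  cdph_mean alpha P U Q1 Q2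
    (fun m n => (((m%:R%:E, n%:R%:E) : \bar R * \bar R) \in A)%:R%:E).
Proof.
move=> mA; rewrite /pushforward.
have mtau : measurable_fun setT (fun w => (tau R M1 w, tau R M2 w)).
  apply/measurable_fun_pairP; split; apply: measurable_exit_time => n o.
    exact: (CDPH_M1_measurable chains).
  exact: (CDPH_M2_measurable chains).
have mB : measurable ((fun w => (tau R M1 w, tau R M2 w)) @^-1` A).
  by rewrite -[X in measurable X]setTI; exact: mtau.
rewrite (probability_partition history_event_measurable _ _ mB); first last.
- under eq_esum do rewrite history_event_prob.
  rewrite -(cdph_mean1 par) -(esum_history par)//.
  by apply: eq_esum => h _; rewrite mule1.
- by move=> h h' _ _ [w [wh wh']]; exact: history_event_inj wh wh'.
rewrite -(esum_history par); last by move=> m n; rewrite lee_fin.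
apply: eq_esum => h _; have [hA|hA] := boolP (_ \in A).
  rewrite mule1 -history_event_prob; congr (Pr _); apply/seteqP.
  split => [w []//|w wh]; split => //; rewrite inE in hA.
  by rewrite /= (history_event_tau1 wh) (history_event_tau2 wh).
rewrite mule0 (_ : _ `&` _ = set0) ?measure0//; apply/seteqP; split => // w [wA wh].
by move/negP: hA; apply; rewrite inE -(history_event_tau1 wh) -(history_event_tau2 wh).
Qed.

End chain_law.

(** * Convolution of the phases of the sum *)

Section block_powers.
Context {R : realType}.

(** A path from the first block to the second makes [a] steps in the first, one
step between them and [N - 1 - a] steps in the second. *)
Lemma power_apply_block_trig m n p (A : 'M[R]_m) (B : 'M[R]_(m, n))
    (D : 'M[R]_n) (G : 'M[R]_(n, p)) N :
  power_apply (block_mx A B 0 D) N (col_mx 0 G) =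
  col_mx (\sum_(a < N) power_apply A a (B *m power_apply D (N.-1 - a) G))
         (power_apply D N G).
Proof.
elim: N => [|N IH]; first by rewrite big_ord0.
rewrite -[LHS]/(_ *m power_apply _ N _) IH mul_block_col mul0mx add0r.
congr col_mx; rewrite big_ord_recl subn0 addrC; congr (_ + _).
rewrite mulmx_sumr; apply: eq_bigr => a _.
by rewrite lift0 /= subnS predn_sub.
Qed.

(** Columns evolve separately, and multiplication by [A] commutes with scaling a
column by [c]. *)
Lemma power_apply_scaled_col m p q (A : 'M[R]_m) (B : 'M[R]_(m, p))
    (C : 'M[R]_(m, q)) j k (c : R) N :
  (forall i, B i j = C i k * c) ->
  forall i, power_apply A N B i j = power_apply A N C i k * c.
Proof.
move=> BC; elim: N => [|N IH] i //=.
by rewrite !mxE mulr_suml; apply: eq_bigr => l _; rewrite IH mulrA.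
Qed.

Lemma power_apply_row_mx0 m p q (A : 'M[R]_m) (B : 'M[R]_(m, p)) N :
  power_apply A N (row_mx B (0 : 'M[R]_(m, q))) = row_mx (power_apply A N B) 0.
Proof. by elim: N => //= N ->; rewrite mul_mx_row mulmx0. Qed.

Lemma power_apply_tensmx1 s1 s2 (Q : 'M[R]_s1) (q : 'cV[R]_s1) (v : 'cV[R]_s2)
    N i l :
  power_apply (Q *t (1%:M : 'M[R]_s2)) N
    (castmx (erefl (s1 * s2)%N, mul1n s2) (q *t (1%:M : 'M[R]_s2)) *m v)
    (mxtens_index (i, l)) 0 =
  power_apply Q N q i 0 * v l 0.
Proof.
elim: N i l => [|N IH] i l /=.
  rewrite mxE (bigD1 l)//= big1 ?addr0 => [|j jl].
    by rewrite castmx_tens_colE [1%:M _ _]mxE eqxx mulr1.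
  by rewrite castmx_tens_colE [1%:M _ _]mxE eq_sym (negbTE jl) mulr0 mul0r.
rewrite mxE sum_mxtens [in RHS]mxE mulr_suml; apply: eq_bigr => i' _.
rewrite (bigD1 l)//= big1 ?addr0 => [|j jl].
  by rewrite tensmxE [1%:M _ _]mxE eqxx mulr1 IH mulrA.
by rewrite tensmxE [1%:M _ _]mxE eq_sym (negbTE jl) mulr0 mul0r.
Qed.

(** The sum terminates only from its second block. *)
Lemma exit_cV_Q_sum s1 s2 (Q : 'M[R]_s1) (Q' : 'M[R]_s2) :
  exit_cV (Q_sum Q Q') = col_mx 0 (exit_cV Q').
Proof.
apply/matrixP => k j; rewrite (ord1 j) exit_cVE.
case: (split_ordP k) => i ->; rewrite /Q_sum /block_mx.
  by under eq_bigr do rewrite col_mxEu; rewrite sum_Q_sum_up subrr col_mxEu mxE.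
rewrite col_mxEd exit_cVE; under eq_bigr do rewrite col_mxEd.
rewrite big_split_ord/= big1 ?add0r => [|l _]; last by rewrite row_mxEl mxE.
by congr (_ - _); apply: eq_bigr => l _; rewrite row_mxEr.
Qed.

(** From [(i, l)] the first coordinate runs until it terminates while [l] is
frozen; the second chain then starts from [l]. *)
Lemma exit_prob_sum s1 s2 (Q : 'M[R]_s1) (Q' : 'M[R]_s2) i l N :
  exit_prob (Q_sum Q Q') (lshift s2 (mxtens_index (i, l))) N =
  \sum_(a < N) exit_prob Q i a * exit_prob Q' l (N.-1 - a)%N.
Proof.
rewrite /exit_prob exit_cV_Q_sum power_apply_block_trig col_mxEu summxE.
by apply: eq_bigr => a _; rewrite power_apply_tensmx1.
Qed.

Section hitting.
Variables (e1 s1 e2 s2 : nat).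
Variables (alpha_1 : 'rV[R]_e1) (P_1 : 'M[R]_e1) (U_1 : 'M[R]_(e1, s1)).
Variables (alpha_2 : 'rV[R]_e2) (P_2 : 'M[R]_e2) (U_2 : 'M[R]_(e2, s2)).
Local Notation U1a2 := (castmx (muln1 e1, erefl (s1 * e2)%N) (U_1 *t alpha_2)).

Lemma power_apply_tens1mx N :
  power_apply ((1%:M : 'M[R]_s1) *t P_2) N
    (row_mx ((1%:M : 'M[R]_s1) *t U_2) (0 : 'M[R]_(_, s2))) =
  row_mx ((1%:M : 'M[R]_s1) *t power_apply P_2 N U_2) 0.
Proof.
rewrite power_apply_row_mx0; congr row_mx.
by elim: N => //= N ->; rewrite tensmx_mul mul1mx.
Qed.

Lemma entrance_tens (W : 'M[R]_(e2, s2)) i j l :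
  (U1a2 *m row_mx ((1%:M : 'M[R]_s1) *t W) (0 : 'M[R]_(_, s2))) i
    (lshift s2 (mxtens_index (j, l))) = U_1 i j * (alpha_2 *m W) 0 l.
Proof.
rewrite mul_mx_row row_mxEl mxE sum_mxtens (bigD1 j)//= [X in _ + X]big1.
  rewrite addr0 mxE mulr_sumr; apply: eq_bigr => m _.
  by rewrite castmx_tens_rowE tensmxE mxE eqxx mul1r mulrA.
move=> j' j'j; rewrite big1// => m _.
by rewrite tensmxE mxE (negbTE j'j) mul0r mulr0.
Qed.

Let hitE T : alpha_sum s1 e2 alpha_1 *m
    power_apply (P_sum P_1 U_1 alpha_2 P_2) T (U_sum e1 s1 U_2) =
  \sum_(t < T) alpha_1 *m power_apply P_1 t (U1a2 *m
    row_mx ((1%:M : 'M[R]_s1) *t power_apply P_2 (T.-1 - t) U_2) 0).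
Proof.
have -> : U_sum e1 s1 U_2 = col_mx (0 : 'M[R]_(e1, _))
    (row_mx ((1%:M : 'M[R]_s1) *t U_2) 0) by rewrite /U_sum /block_mx row_mx0.
rewrite power_apply_block_trig mul_row_col mul0mx addr0 mulmx_sumr.
by apply: eq_bigr => t _; rewrite power_apply_tens1mx.
Qed.

(** The second chain starts from [alpha_2] at the step at which the first one
enters S, and the state [j] of the first one is kept while the second one is in
its E-phase. *)
Lemma hit_prob_sum T j l :
  hit_prob (alpha_sum s1 e2 alpha_1) (P_sum P_1 U_1 alpha_2 P_2)
    (U_sum e1 s1 U_2) T (lshift s2 (mxtens_index (j, l))) =
  \sum_(t < T) hit_prob alpha_1 P_1 U_1 t j *
               hit_prob alpha_2 P_2 U_2 (T.-1 - t)%N l.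
Proof.
rewrite /hit_prob hitE summxE; apply: eq_bigr => t _.
rewrite [LHS]mxE [X in X * _]mxE mulr_suml; apply: eq_bigr => i _.
rewrite -mulrA; congr (_ * _); apply: power_apply_scaled_col => i'.
exact: entrance_tens.
Qed.

(** The columns of [U_sum] over the second part of the S-states vanish, so this
part is not entered directly. *)
Lemma hit_prob_sum0 T l :
  hit_prob (alpha_sum s1 e2 alpha_1) (P_sum P_1 U_1 alpha_2 P_2)
    (U_sum e1 s1 U_2) T (rshift (s1 * s2) l) = 0.
Proof.
rewrite /hit_prob hitE summxE big1// => t _.
by rewrite mul_mx_row mulmx0 power_apply_row_mx0 mul_mx_row mulmx0 row_mxEr mxE.
Qed.

End hitting.
End block_powers.

Section mean_convolution.
Local Open Scope ereal_scope.
Context {R : realType}.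

(** Nested sums as a single one, so that they can be compared by reindexing. *)
Lemma esum_flatten (X Y Z : choiceType) (f : X -> R) (p : X -> Y -> R)
    (q : X -> Z -> R) (g : X -> Y -> Z -> \bar R) :
  (forall x, 0 <= f x)%R -> (forall x y, 0 <= p x y)%R ->
  (forall x z, 0 <= q x z)%R -> (forall x y z, 0 <= g x y z) ->
  \esum_(x in [set: X]) ((f x)%:E * \esum_(y in [set: Y]) ((p x y)%:E *
    \esum_(z in [set: Z]) ((q x z)%:E * g x y z))) =
  \esum_(v in [set: X * (Y * Z)])
    ((f v.1 * p v.1 v.2.1 * q v.1 v.2.2)%:E * g v.1 v.2.1 v.2.2).
Proof.
move=> f0 p0 q0 g0.
have F0 x y z : 0 <= (f x * p x y * q x z)%:E * g x y z.
  by rewrite mule_ge0// lee_fin !mulr_ge0.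
rewrite -(@esum_pair _ _ _ (fun x w => (f x * p x w.1 * q x w.2)%:E * g x w.1 w.2))//.
apply: eq_esum => x _.
rewrite -(@esum_pair _ _ _ (fun y z => (f x * p x y * q x z)%:E * g x y z))//.
rewrite -esumZl//; last first.
  by move=> y; rewrite mule_ge0 ?lee_fin// esum_ge0// => z _; rewrite mule_ge0// lee_fin.
apply: eq_esum => y _; rewrite muleA -EFinM -esumZl ?mulr_ge0//; last first.
  by move=> z; rewrite mule_ge0// lee_fin.
by apply: eq_esum => z _; rewrite EFinM muleA.
Qed.

Section flat.
Context {e s : nat}.
Variables (alpha : 'rV[R]_e) (P : 'M[R]_e) (U : 'M[R]_(e, s)) (Q1 Q2 : 'M[R]_s).

Definition mean_index := ((nat * 'I_s) * (nat * nat))%type.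

Definition mean_weight (v : mean_index) : R :=
  (hit_prob alpha P U v.1.1 v.1.2 * exit_prob Q1 v.1.2 v.2.1 *
   exit_prob Q2 v.1.2 v.2.2)%R.

Hypothesis par : CDPH_parameters alpha P U Q1 Q2.

Lemma mean_weight_ge0 v : (0 <= mean_weight v)%R.
Proof.
rewrite !mulr_ge0 ?(hit_prob_ge0 par)//.
- exact: exit_prob_ge0 (CDPH_Q1_subprobability par).
- exact: exit_prob_ge0 (CDPH_Q2_subprobability par).
Qed.

Lemma cdph_mean_flat g : (forall m n, 0 <= g m n) ->
  cdph_mean alpha P U Q1 Q2 g =
  \esum_(v in [set: mean_index])
    ((mean_weight v)%:E * g (v.1.1 + v.2.1).+2 (v.1.1 + v.2.2).+2).
Proof.
move=> g0.
have r1 k a : (0 <= exit_prob Q1 k a)%R.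
  exact: exit_prob_ge0 (CDPH_Q1_subprobability par).
have r2 k a : (0 <= exit_prob Q2 k a)%R.
  exact: exit_prob_ge0 (CDPH_Q2_subprobability par).
rewrite /cdph_mean esum_pair; last first.
  move=> t k; rewrite mule_ge0 ?lee_fin ?(hit_prob_ge0 par)// esum_ge0// => a _.
  by rewrite mule_ge0 ?lee_fin// esum_ge0// => b _; rewrite mule_ge0 ?lee_fin.
rewrite (esum_flatten (f := fun x => hit_prob alpha P U x.1 x.2)
  (p := fun x => exit_prob Q1 x.2) (q := fun x => exit_prob Q2 x.2)
  (g := fun x a b => g (x.1 + a).+2 (x.1 + b).+2))//.
by move=> x; exact: hit_prob_ge0 par _ _.
Qed.

End flat.

(** After convolution on the left, both sides are sums over two quadruples
[(t, j, a, b)] and [(t', l, a', b')] with the same weights; the three shifts by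
one in the convolutions add up with the second successors: [t + t' + 1 + a + a'
+ 1 + 2] is the sum of [t + a + 2] and [t' + a' + 2]. *)
Lemma cdph_mean_sum (e1 s1 e2 s2 : nat)
    (alpha_1 : 'rV[R]_e1) (P_1 : 'M[R]_e1) (U_1 : 'M[R]_(e1, s1))
    (Q1_1 Q2_1 : 'M[R]_s1)
    (alpha_2 : 'rV[R]_e2) (P_2 : 'M[R]_e2) (U_2 : 'M[R]_(e2, s2))
    (Q1_2 Q2_2 : 'M[R]_s2) (g : nat -> nat -> \bar R) :
  CDPH_parameters alpha_1 P_1 U_1 Q1_1 Q2_1 ->
  CDPH_parameters alpha_2 P_2 U_2 Q1_2 Q2_2 ->
  (forall m n, 0 <= g m n) ->
  cdph_mean (alpha_sum s1 e2 alpha_1) (P_sum P_1 U_1 alpha_2 P_2)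
    (U_sum e1 s1 U_2) (Q_sum Q1_1 Q1_2) (Q_sum Q2_1 Q2_2) g =
  cdph_mean alpha_1 P_1 U_1 Q1_1 Q2_1 (fun m n =>
    cdph_mean alpha_2 P_2 U_2 Q1_2 Q2_2 (fun m' n' => g (m + m')%N (n + n')%N)).
Proof.
move=> par1 par2 g0.
pose c1 := hit_prob alpha_1 P_1 U_1; pose c2 := hit_prob alpha_2 P_2 U_2.
have c10 t k : (0 <= c1 t k)%R by exact: hit_prob_ge0 par1 _ _.
have c20 t k : (0 <= c2 t k)%R by exact: hit_prob_ge0 par2 _ _.
have r11 k a : (0 <= exit_prob Q1_1 k a)%R.
  exact: exit_prob_ge0 (CDPH_Q1_subprobability par1).
have r12 k a : (0 <= exit_prob Q1_2 k a)%R.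
  exact: exit_prob_ge0 (CDPH_Q1_subprobability par2).
have r21 k a : (0 <= exit_prob Q2_1 k a)%R.
  exact: exit_prob_ge0 (CDPH_Q2_subprobability par1).
have r22 k a : (0 <= exit_prob Q2_2 k a)%R.
  exact: exit_prob_ge0 (CDPH_Q2_subprobability par2).
pose H2 j l m n := \esum_(b in [set: nat * nat])
  ((exit_prob Q2_1 j b.1 * exit_prob Q2_2 l b.2)%:E *
    g m (n + (b.1 + b.2).+1).+2).
have H20 j l m n : 0 <= H2 j l m n.
  by apply: esum_ge0 => b _; rewrite mule_ge0// lee_fin mulr_ge0.
pose H1 j l n := \esum_(a in [set: nat * nat])
  ((exit_prob Q1_1 j a.1 * exit_prob Q1_2 l a.2)%:E *
    H2 j l (n + (a.1 + a.2).+1).+2 n).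
have H10 j l n : 0 <= H1 j l n.
  by apply: esum_ge0 => b _; rewrite mule_ge0// lee_fin mulr_ge0.
transitivity (\esum_(x in [set: ('I_s1 * 'I_s2) * (nat * nat)])
    ((c1 x.2.1 x.1.1 * c2 x.2.2 x.1.2)%:E * H1 x.1.1 x.1.2 (x.2.1 + x.2.2).+1)).
  transitivity (\esum_(T in [set: nat]) \esum_(jl in [set: 'I_s1 * 'I_s2])
      ((\sum_(t < T) c1 t jl.1 * c2 (T.-1 - t)%N jl.2)%:E * H1 jl.1 jl.2 T)).
    apply: eq_esum => T _.
    have par := CDPH_parameters_sum par1 par2.
    pose inner (k : 'I_(s1 * s2 + s2)) :=
      \esum_(a in [set: nat]) ((exit_prob (Q_sum Q1_1 Q1_2) k a)%:E *
      \esum_(b in [set: nat]) ((exit_prob (Q_sum Q2_1 Q2_2) k b)%:E *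
       g (T + a).+2 (T + b).+2)).
    have inner0 k : 0 <= inner k.
      apply: esum_ge0 => a _; rewrite mule_ge0 ?lee_fin ?exit_prob_ge0//.
        exact: CDPH_Q1_subprobability par.
      apply: esum_ge0 => b _; rewrite mule_ge0 ?lee_fin ?exit_prob_ge0//.
      exact: CDPH_Q2_subprobability par.
    (* Only the pairs of entrance states contribute: see hit_prob_sum0. *)
    have innerE j l : inner (lshift s2 (mxtens_index (j, l))) = H1 j l T.
      rewrite /inner; under eq_esum do rewrite exit_prob_sum.
      transitivity (\esum_(a in [set: nat])
          ((\sum_(a' < a) exit_prob Q1_1 j a' * exit_prob Q1_2 l (a.-1 - a')%N)%:E *
           H2 j l (T + a).+2 T)).
        apply: eq_esum => a _; congr (_ * _).
        under eq_esum do rewrite exit_prob_sum.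
        rewrite (esum_convolution
          (F := fun b b' => (exit_prob Q2_1 j b * exit_prob Q2_2 l b')%R)
          (H := fun b => g (T + a).+2 (T + b).+2))//; last by move=> *; exact: mulr_ge0.
        by rewrite esum_pair// => b b'; rewrite mule_ge0// lee_fin mulr_ge0.
      rewrite (esum_convolution
        (F := fun a a' => (exit_prob Q1_1 j a * exit_prob Q1_2 l a')%R)
        (H := fun a => H2 j l (T + a).+2 T))//; last by move=> *; exact: mulr_ge0.
      by rewrite esum_pair// => b b'; rewrite mule_ge0// lee_fin mulr_ge0.
    rewrite -[LHS]/(\esum_(k in [set: 'I_(s1 * s2 + s2)]) (_ * inner k)).
    rewrite -(@esum_pair _ _ _ (fun j l =>
      ((\sum_(t < T) c1 t j * c2 (T.-1 - t)%N l)%:E * H1 j l T))); last first.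
      by move=> j l; rewrite mule_ge0// lee_fin sumr_ge0// => t _; exact: mulr_ge0.
    rewrite !esum_finType; first last.
    - by move=> k; rewrite mule_ge0// lee_fin (hit_prob_ge0 par).
    - move=> j; apply: esum_ge0 => l _.
      by rewrite mule_ge0// lee_fin sumr_ge0// => t _; exact: mulr_ge0.
    rewrite big_split_ord/= [X in _ + X]big1 ?addr0; last first.
      by move=> l _; rewrite hit_prob_sum0 mul0e.
    rewrite sum_mxtens; apply: eq_bigr => j _.
    rewrite esum_finType; last first.
      by move=> l; rewrite mule_ge0// lee_fin sumr_ge0// => t _; exact: mulr_ge0.
    by apply: eq_bigr => l _; rewrite innerE hit_prob_sum.
  rewrite exchange_esum; last first.
    move=> T jl; rewrite mule_ge0// lee_fin sumr_ge0// => t _; exact: mulr_ge0.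
  rewrite -(@esum_pair _ _ _ (fun jl tt =>
    ((c1 tt.1 jl.1 * c2 tt.2 jl.2)%:E * H1 jl.1 jl.2 (tt.1 + tt.2).+1))); last first.
    by move=> jl tt; rewrite mule_ge0// lee_fin mulr_ge0.
  apply: eq_esum => -[j l] _ /=.
  rewrite (esum_convolution (F := fun t t' => (c1 t j * c2 t' l)%R)
    (H := H1 j l))//; last by move=> *; exact: mulr_ge0.
  by rewrite esum_pair// => t t'; rewrite mule_ge0// lee_fin mulr_ge0.
rewrite /H1 /H2 (esum_flatten
  (f := fun x : ('I_s1 * 'I_s2) * (nat * nat) => (c1 x.2.1 x.1.1 * c2 x.2.2 x.1.2)%R)
  (p := fun x a => (exit_prob Q1_1 x.1.1 a.1 * exit_prob Q1_2 x.1.2 a.2)%R)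
  (q := fun x b => (exit_prob Q2_1 x.1.1 b.1 * exit_prob Q2_2 x.1.2 b.2)%R)
  (g := fun x a b => g ((x.2.1 + x.2.2).+1 + (a.1 + a.2).+1).+2
     ((x.2.1 + x.2.2).+1 + (b.1 + b.2).+1).+2))//; do ?by move=> *; exact: mulr_ge0.
have w1 := mean_weight_ge0 par1; have w2 := mean_weight_ge0 par2.
rewrite (cdph_mean_flat par1); last first.
  move=> m n; rewrite (cdph_mean_flat par2)//.
  by apply: esum_ge0 => v _; rewrite mule_ge0// lee_fin.
transitivity (\esum_(v in [set: mean_index]) \esum_(v' in [set: mean_index])
   ((mean_weight alpha_1 P_1 U_1 Q1_1 Q2_1 v *
     mean_weight alpha_2 P_2 U_2 Q1_2 Q2_2 v')%:E *
     g ((v.1.1 + v.2.1).+2 + (v'.1.1 + v'.2.1).+2)%N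
       ((v.1.1 + v.2.2).+2 + (v'.1.1 + v'.2.2).+2)%N)); last first.
  apply: eq_esum => v _; rewrite (cdph_mean_flat par2)// -esumZl//; last first.
    by move=> v'; rewrite mule_ge0// lee_fin.
  by apply: eq_esum => v' _; rewrite EFinM muleA.
rewrite esum_pair; last first.
  by move=> v v'; rewrite mule_ge0// lee_fin mulr_ge0.
pose shuffle (vv : mean_index * mean_index) :
    (('I_s1 * 'I_s2) * (nat * nat)) * ((nat * nat) * (nat * nat)) :=
  let: (((t, j), (a, b)), ((t', l), (a', b'))) := vv in
  (((j, l), (t, t')), ((a, a'), (b, b'))).
rewrite (reindex_esum setT _ shuffle)//.
  apply: eq_esum => -[[[t j] [a b]] [[t' l] [a' b']]] _ /=.
  rewrite /mean_weight /=; congr ((_ : R)%:E * g _ _); [rewrite /c1 /c2; ring|lia|lia].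
split => //.
  by move=> [[[t j] [a b]] [[t' l] [a' b']]] [[[? ?] [? ?]] [[? ?] [? ?]]] _ _
    /= [-> -> -> -> -> -> -> ->].
move=> [[[j l] [t t']] [[a a'] [b b']]] _.
by exists (((t, j), (a, b)), ((t', l), (a', b'))).
Qed.

End mean_convolution.

(** * Sums of independent pairs *)

Section atoms.
Local Open Scope ereal_scope.
Context {R : realType}.

Definition nat_point (u : nat * nat) : \bar R * \bar R := (u.1%:R%:E, u.2%:R%:E).

Lemma nat_point_inj : injective nat_point.
Proof.
move=> [m n] [m' n'] [/eqP + /eqP]; rewrite !eqr_nat.
by move=> /eqP -> /eqP ->.
Qed.

Lemma measurable_nat_point u : measurable [set nat_point u].
Proof.
rewrite (_ : [set _] = [set u.1%:R%:E] `*` [set u.2%:R%:E]).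
  by apply: measurableX; exact: emeasurable_set1.
by apply/seteqP; split => [_ ->//|[a b] [/= -> ->]].
Qed.

Context {e s : nat}.
Context {alpha : 'rV[R]_e} {P : 'M[R]_e} {U : 'M[R]_(e, s)} {Q1 Q2 : 'M[R]_s}.
Hypothesis par : CDPH_parameters alpha P U Q1 Q2.
Local Notation mean := (cdph_mean alpha P U Q1 Q2).

Lemma le_cdph_mean g h : (forall m n, 0 <= g m n) ->
  (forall m n, g m n <= h m n) -> mean g <= mean h.
Proof.
move=> g0 gh; rewrite !(cdph_mean_flat par)//; last first.
  by move=> m n; exact: le_trans (g0 m n) (gh m n).
by apply: le_esum => v _; rewrite lee_wpmul2l// lee_fin (mean_weight_ge0 par).
Qed.

Lemma cdph_mean_ge0 g : (forall m n, 0 <= g m n) -> 0 <= mean g.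
Proof.
move=> g0; rewrite (cdph_mean_flat par)//; apply: esum_ge0 => v _.
by rewrite mule_ge0// lee_fin (mean_weight_ge0 par).
Qed.

Lemma cdph_mean_fin g : (forall m n, 0 <= g m n <= 1) -> mean g \is a fin_num.
Proof.
move=> g01; have g0 m n : 0 <= g m n by case/andP: (g01 m n).
rewrite ge0_fin_numE ?cdph_mean_ge0//; apply: (@le_lt_trans _ _ 1); last exact: ltry.
by rewrite -(cdph_mean1 par); apply: le_cdph_mean => // m n; case/andP: (g01 m n).
Qed.

(** [cdph_mean] is the expectation under the discrete law given by its atoms. *)
Lemma esum_atoms (g : nat * nat -> R) : (forall u, 0 <= g u)%R ->
  \esum_(u in [set: nat * nat])
    (mean (fun m n => ((m, n) == u)%:R%:E) * (g u)%:E) =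
  mean (fun m n => (g (m, n))%:E).
Proof.
move=> g0; have w0 := mean_weight_ge0 par.
transitivity (\esum_(u in [set: nat * nat]) \esum_(v in [set: mean_index])
    ((g u)%:E * ((mean_weight alpha P U Q1 Q2 v)%:E *
      (((v.1.1 + v.2.1).+2, (v.1.1 + v.2.2).+2) == u)%:R%:E))).
  apply: eq_esum => u _; rewrite muleC (cdph_mean_flat par); last first.
    by move=> m n; rewrite lee_fin.
  rewrite -esumZl//.
  by move=> v; rewrite -EFinM lee_fin mulr_ge0.
rewrite exchange_esum; last first.
  by move=> u v; rewrite !mule_ge0 ?lee_fin ?ler0n.
rewrite (cdph_mean_flat par); last by move=> m n; rewrite lee_fin.
apply: eq_esum => v _.
set u0 := (_, _).
rewrite (esumID [set u0]); last first.
  by move=> u _; rewrite !mule_ge0 ?lee_fin ?ler0n.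
rewrite !setTI esum_set1; last by rewrite !mule_ge0 ?lee_fin ?ler0n.
rewrite esum1 ?adde0 ?eqxx ?mule1 1?muleC// => u /= uu0.
by rewrite (_ : (u0 == u) = false) ?mule0//; apply/eqP => /esym.
Qed.

End atoms.

(** Both pairs lie almost surely in the lattice of natural points, so the space
is partitioned by the values [(u, v)] of the two pairs, whose joint
probabilities are products by independence. *)
Lemma independent_sum_law (R : realType) (e1 s1 e2 s2 : nat)
    (alpha_1 : 'rV[R]_e1) (P_1 : 'M[R]_e1) (U_1 : 'M[R]_(e1, s1))
    (Q1_1 Q2_1 : 'M[R]_s1)
    (alpha_2 : 'rV[R]_e2) (P_2 : 'M[R]_e2) (U_2 : 'M[R]_(e2, s2))
    (Q1_2 Q2_2 : 'M[R]_s2)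
    (d : measure_display) (Omega : measurableType d)
    (Pr : probability Omega R)
    (X1 X2 Y1 Y2 : {RV Pr >-> \bar R}) :
  CDPH_parameters alpha_1 P_1 U_1 Q1_1 Q2_1 ->
  CDPH_parameters alpha_2 P_2 U_2 Q1_2 Q2_2 ->
  (forall u, Pr [set w | (X1 w, X2 w) = nat_point u] =
     cdph_mean alpha_1 P_1 U_1 Q1_1 Q2_1 (fun m n => ((m, n) == u)%:R%:E)) ->
  (forall u, Pr [set w | (Y1 w, Y2 w) = nat_point u] =
     cdph_mean alpha_2 P_2 U_2 Q1_2 Q2_2 (fun m n => ((m, n) == u)%:R%:E)) ->
  independent_pairs Pr (fun w => (X1 w, X2 w)) (fun w => (Y1 w, Y2 w)) ->
  forall A : set (\bar R * \bar R), measurable A ->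
  (Pr ((fun w => (X1 w + Y1 w, X2 w + Y2 w)) @^-1` A) =
  cdph_mean alpha_1 P_1 U_1 Q1_1 Q2_1 (fun m n =>
    cdph_mean alpha_2 P_2 U_2 Q1_2 Q2_2 (fun m' n' =>
      (nat_point (m + m', n + n')%N \in A)%:R%:E)))%E.
Proof.
move=> par1 par2 atoms1 atoms2 indep A mA.
pose H (uv : (nat * nat) * (nat * nat)) :=
  [set w | (X1 w, X2 w) = nat_point uv.1] `&` [set w | (Y1 w, Y2 w) = nat_point uv.2].
have mX (Z : {RV Pr >-> \bar R}) : measurable_fun setT Z by exact: measurable_funPT.
have mpair (Z Z' : {RV Pr >-> \bar R}) u :
    measurable [set w | (Z w, Z' w) = nat_point u].
  rewrite -[X in measurable X]setTI.
  have mZ : measurable_fun setT (fun w => (Z w, Z' w)).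
    by apply/measurable_fun_pairP; split; exact: mX.
  exact: (mZ measurableT _ (measurable_nat_point u)).
have mH uv : measurable (H uv) by apply: measurableI; exact: mpair.
have mB : measurable ((fun w => ((X1 w + Y1 w)%E, (X2 w + Y2 w)%E)) @^-1` A).
  rewrite -[X in measurable X]setTI.
  have mS : measurable_fun setT (fun w => ((X1 w + Y1 w)%E, (X2 w + Y2 w)%E)).
    by apply/measurable_fun_pairP; split; apply: emeasurable_funD; exact: mX.
  exact: mS.
have tH : trivIset setT H.
  move=> [u v] [u' v'] _ _ [w [[/= Xu Yv] [/= Xu' Yv']]].
  rewrite (nat_point_inj (etrans (esym Xu) Xu')).
  by rewrite (nat_point_inj (etrans (esym Yv) Yv')).
pose p u := cdph_mean alpha_1 P_1 U_1 Q1_1 Q2_1 (fun m n => ((m, n) == u)%:R%:E).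
pose q v := cdph_mean alpha_2 P_2 U_2 Q1_2 Q2_2 (fun m n => ((m, n) == v)%:R%:E).
have PrH u v : Pr (H (u, v)) = (p u * q v)%E.
  rewrite /p /q -atoms1 -atoms2.
  exact: (indep _ _ (measurable_nat_point u) (measurable_nat_point v)).
have ind01 u m n : (0 <= ((((m, n) : nat * nat) == u)%:R : R)%:E <= 1)%E.
  by case: eqP; rewrite !lee_fin ?lexx ?ler01.
have pfin u : p u \is a fin_num by apply: cdph_mean_fin par1 _ _ => m n; exact: ind01.
have p0 u : (0 <= p u)%E by apply: cdph_mean_ge0 par1 _ _ => m n; rewrite lee_fin.
have q0 u : (0 <= q u)%E by apply: cdph_mean_ge0 par2 _ _ => m n; rewrite lee_fin.
(* The inner expectation is at most 1, hence finite; as a real function it can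
   be summed against the atoms of the first pair. *)
pose G (C : set (\bar R * \bar R)) u := fine (cdph_mean alpha_2 P_2 U_2 Q1_2 Q2_2
  (fun m n => (nat_point (u.1 + m, u.2 + n)%N \in C)%:R%:E)).
have GE C u : (G C u)%:E = cdph_mean alpha_2 P_2 U_2 Q1_2 Q2_2
    (fun m n => (nat_point (u.1 + m, u.2 + n)%N \in C)%:R%:E).
  rewrite fineK//; apply: cdph_mean_fin par2 _ _ => m n.
  by case: (_ \in _); rewrite !lee_fin ?lexx ?ler01.
have G0 C u : 0 <= G C u.
  by rewrite fine_ge0//; apply: cdph_mean_ge0 par2 _ _ => m n; rewrite lee_fin.
have sum_atoms C : (\esum_(uv in [set: (nat * nat) * (nat * nat)])
    (p uv.1 * (q uv.2 *
       (nat_point (uv.1.1 + uv.2.1, uv.1.2 + uv.2.2)%N \in C)%:R%:E)) =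
  cdph_mean alpha_1 P_1 U_1 Q1_1 Q2_1 (fun m n => (G C (m, n))%:E))%E.
  rewrite -(esum_atoms par1)//.
  rewrite -(@esum_pair _ _ _ (fun u v : nat * nat => p u * (q v *
    (nat_point (u.1 + v.1, u.2 + v.2)%N \in C)%:R%:E))%E); last first.
    by move=> u v; rewrite !mule_ge0// lee_fin.
  apply: eq_esum => u _.
  rewrite GE -(esum_atoms par2 (g := fun v =>
    (nat_point (u.1 + v.1, u.2 + v.2)%N \in C)%:R))//.
  rewrite -/(p u) -(fineK (pfin u)) esumZl// ?fine_ge0//.
  by move=> v; rewrite mule_ge0// lee_fin.
have sumH : (\esum_(uv in [set: (nat * nat) * (nat * nat)]) Pr (H uv) = 1)%E.
  transitivity (\esum_(uv in [set: (nat * nat) * (nat * nat)])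
    (p uv.1 * (q uv.2 *
       (nat_point (uv.1.1 + uv.2.1, uv.1.2 + uv.2.2)%N
          \in [set: \bar R * \bar R])%:R%:E)))%E.
    by apply: eq_esum => -[u v] _; rewrite PrH in_setT mule1.
  rewrite sum_atoms -(cdph_mean1 par1); congr cdph_mean.
  apply/funext => m; apply/funext => n; rewrite GE -(cdph_mean1 par2).
  by congr cdph_mean; apply/funext => m'; apply/funext => n'; rewrite in_setT.
rewrite (probability_partition mH tH sumH mB).
transitivity (\esum_(uv in [set: (nat * nat) * (nat * nat)])
    (p uv.1 * (q uv.2 *
       (nat_point (uv.1.1 + uv.2.1, uv.1.2 + uv.2.2)%N \in A)%:R%:E)))%E; last first.
  by rewrite sum_atoms; congr cdph_mean; apply/funext => m; apply/funext => n; rewrite GE.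
apply: eq_esum => -[u v] _ /=.
have addE w : H (u, v) w ->
    ((X1 w + Y1 w)%E, (X2 w + Y2 w)%E) = nat_point (u.1 + v.1, u.2 + v.2)%N.
  by move=> [[-> ->] [-> ->]]; rewrite /nat_point /= !natrD.
have [uvA|uvA] := boolP (_ \in A).
  rewrite mule1 -PrH; congr (Pr _); apply/seteqP; split => [w []//|w wH].
  by split => //; rewrite inE in uvA; rewrite /= addE.
rewrite !mule0 (_ : _ `&` _ = set0) ?measure0//; apply/seteqP; split => // w [wA wH].
by move/negP: uvA; apply; rewrite inE -(addE w wH).
Qed.

(* Suffix _i refers to the i-th CDPH pair; Qk_i is Q_k(i) and tauk_i is
   tau_k(i). *)
Theorem proposition2p9 (R : realType) (e1 s1 e2 s2 : nat)
    (alpha_1 : 'rV[R]_e1) (P_1 : 'M[R]_e1) (U_1 : 'M[R]_(e1, s1))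
    (Q1_1 Q2_1 : 'M[R]_s1)
    (alpha_2 : 'rV[R]_e2) (P_2 : 'M[R]_e2) (U_2 : 'M[R]_(e2, s2))
    (Q1_2 Q2_2 : 'M[R]_s2)
    (d : measure_display) (Omega : measurableType d)
    (Pr : probability Omega R)
    (tau1_1 tau2_1 tau1_2 tau2_2 : {RV Pr >-> \bar R})
    (law_1 : CDPH alpha_1 P_1 U_1 Q1_1 Q2_1
               (pushforward Pr (fun w => (tau1_1 w, tau2_1 w))))
    (law_2 : CDPH alpha_2 P_2 U_2 Q1_2 Q2_2
               (pushforward Pr (fun w => (tau1_2 w, tau2_2 w))))
    (indep : independent_pairs Pr (fun w => (tau1_1 w, tau2_1 w))
                                  (fun w => (tau1_2 w, tau2_2 w))) :
  CDPH (alpha_sum s1 e2 alpha_1) (P_sum P_1 U_1 alpha_2 P_2)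
    (U_sum e1 s1 U_2) (Q_sum Q1_1 Q1_2) (Q_sum Q2_1 Q2_2)
    (pushforward Pr (fun w =>
       ((tau1_1 w + tau1_2 w)%E, (tau2_1 w + tau2_2 w)%E))).

Proof.
have [par1 [d1 [T1 [Pr1 [M1 [M2 [chains1 law1]]]]]]] := law_1.
have [par2 [d2 [T2 [Pr2 [N1 [N2 [chains2 law2]]]]]]] := law_2.
have par := CDPH_parameters_sum par1 par2; split => //.
have [d0 [T [Pr0 [L1 [L2 chains]]]]] := CDPH_chains_exist par.
exists d0, T, Pr0, L1, L2; split => // A mA.
rewrite (chains_law par chains)// (cdph_mean_sum par1 par2)//.
have atoms e s (alpha : 'rV[R]_e) (P : 'M[R]_e) (U : 'M[R]_(e, s)) (Q1 Q2 : 'M[R]_s)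
    (u : nat * nat) :
  cdph_mean alpha P U Q1 Q2 (fun m n =>
    (((m%:R%:E, n%:R%:E) : \bar R * \bar R) \in [set nat_point u])%:R%:E) =
  cdph_mean alpha P U Q1 Q2 (fun m n => ((m, n) == u)%:R%:E).
  congr cdph_mean; apply/funext => m; apply/funext => n; congr ((nat_of_bool _)%:R%:E).
  apply/idP/eqP => [|<-]; rewrite inE//= => mnu.
  exact: (@nat_point_inj R (m, n) u mnu).
apply: (independent_sum_law par1 par2 _ _ indep mA) => u; rewrite -atoms.
  rewrite -(chains_law par1 chains1) -?law1//; exact: measurable_nat_point.
rewrite -(chains_law par2 chains2) -?law2//; exact: measurable_nat_point.
Qed.
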